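(* Let $r,l\ge 0$ be integers, let $\boldsymbol{\omega}=(\omega_1,\dots,\omega_r)$ and $\boldsymbol{\alpha}=(\alpha_1,\dots,\alpha_l)$ be tuples of complex numbers with positive real parts, let $a\in\mathbb{C}$ be fixed, and let $k\ge -(r+l)$ be an integer. Then, as $|w|\to\infty$ in any sector $|\arg w|\le \pi/2-\delta$ ($\delta>0$ fixed), $$P_{r+l}\big(k,w+a;(\boldsymbol{\omega},\boldsymbol{\alpha})\big)=\sum_{N=-l}^{r+k} a_{l,N}(a;\boldsymbol{\alpha})\,P_{r}(k-N,w;\boldsymbol{\omega})+O\!\left(\frac{1}{w}\right).$$
   Context: For a tuple $\boldsymbol{\omega}=(\omega_1,\dots,\omega_r)$ of complex numbers with positive real parts put $f_{\boldsymbol{\omega}}(t)=\prod_{j=1}^r(1-e^{-\omega_j t})^{-1}$ (for $r=0$, $\boldsymbol{\omega}=\emptyset$ and $f_\emptyset=1$). The multiple Bernoulli polynomials $a_{r,n}(w;\boldsymbol{\omega})$ ($n\in\mathbb{Z}$) are defined by the Laurent expansion at $t=0$ $$f_{\boldsymbol{\omega}}(t)e^{-wt}=\sum_{n\ge -r}a_{r,n}(w;\boldsymbol{\omega})t^n,$$ with $a_{r,n}=0$ for $n<-r$. Fix $0<\lambda<\min_i|2\pi/\omega_i|$ (any $\lambda>0$ if $r=0$). $I(\lambda,\infty)$ denotes the path consisting of the half-line from $+\infty$ to $\lambda$, the circle $|t|=\lambda$ traversed once in the positive sense, and the half-line from $\lambda$ to $+\infty$; along it $\log t$ is the branch with $\arg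 t=0$ on the incoming half-line, varying continuously along the circle, so $\arg t=2\pi$ on the outgoing half-line. For an integer $k$ and $\mathrm{Re}(w)>0$ define $$P_r(k,w;\boldsymbol{\omega})=\frac{1}{2\pi i}\int_{I(\lambda,\infty)}f_{\boldsymbol{\omega}}(t)e^{-wt}t^{-k-1}\log t\,dt+(\gamma-\pi i)\,a_{r,k}(w;\boldsymbol{\omega}),$$ where $\gamma$ is Euler's constant. $(\boldsymbol{\omega},\boldsymbol{\alpha})$ denotes the concatenated $(r+l)$-tuple. *)

(* Defs.v *)
From Stdlib Require Import Reals Lra Lia ZArith List ClassicalEpsilon.
Open Scope R_scope.

Definition CC : Type := (R * R)%type.
Definition RtoC (x : R) : CC := (x, 0).
Definition C0 : CC := (0, 0).
Definition C1 : CC := (1, 0).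
Definition Ci : CC := (0, 1).
Definition Re (z : CC) : R := fst z.
Definition Im (z : CC) : R := snd z.
Definition Cadd (z u : CC) : CC := (fst z + fst u, snd z + snd u).
Definition Copp (z : CC) : CC := (- fst z, - snd z).
Definition Csub (z u : CC) : CC := Cadd z (Copp u).
Definition Cmul (z u : CC) : CC :=
  (fst z * fst u - snd z * snd u, fst z * snd u + snd z * fst u).
Definition Cinv (z : CC) : CC :=
  (fst z / (fst z ^ 2 + snd z ^ 2), - snd z / (fst z ^ 2 + snd z ^ 2)).
Definition Cnorm (z : CC) : R := sqrt (fst z ^ 2 + snd z ^ 2).
Definition Cexp (z : CC) : CC := (exp (fst z) * cos (snd z), exp (fst z) * sin (snd z)).
Fixpoint Cpow (z : CC) (n : nat) : CC :=
  match n with O => C1 | S m => Cmul z (Cpow z m) end.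
Definition Cpowz (z : CC) (k : Z) : CC :=
  if (0 <=? k)%Z then Cpow z (Z.to_nat k) else Cinv (Cpow z (Z.to_nat (- k))).

Lemma C_inhabited : inhabited CC.
Proof. exact (inhabits C0). Qed.

Definition sumZ (m n : Z) (F : Z -> CC) : CC :=
  fold_right (fun j acc => Cadd (F (m + Z.of_nat j)%Z) acc) C0
             (seq 0 (Z.to_nat (n - m + 1))).

Definition f_omega (om : list CC) (t : CC) : CC :=
  fold_right (fun o acc => Cmul (Cinv (Csub C1 (Cexp (Copp (Cmul o t))))) acc) C1 om.

Definition laurent_partial (r : nat) (c : Z -> CC) (N : nat) (t : CC) : CC :=
  fold_right (fun j acc =>
      Cadd (Cmul (c (Z.of_nat j - Z.of_nat r)%Z) (Cpowz t (Z.of_nat j - Z.of_nat r)%Z)) acc)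
    C0 (seq 0 (S N)).

Definition laurent_expansion (F : CC -> CC) (r : nat) (c : Z -> CC) : Prop :=
  (forall n : Z, (n < - Z.of_nat r)%Z -> c n = C0) /\
  exists rho : R, 0 < rho /\
    forall t : CC, 0 < Cnorm t < rho ->
      forall eps : R, 0 < eps -> exists N0 : nat, forall N : nat, (N0 <= N)%nat ->
        Cnorm (Csub (laurent_partial r c N t) (F t)) < eps.

(** multiple Bernoulli polynomial a_{r,n}(w; omega), with r = length omega:
    the (unique) Laurent coefficients of f_omega(t) e^{-wt}. *)
Definition abern (n : Z) (w : CC) (om : list CC) : CC :=
  epsilon (inhabits (fun _ : Z => C0))
    (fun c => laurent_expansion (fun t => Cmul (f_omega om t) (Cexp (Copp (Cmul w t))))
                                (length om) c) n.

Definition CRInt (h : R -> CC) (a b : R) (v : CC) : Prop :=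
  (exists pr : Riemann_integrable (fun x => fst (h x)) a b, RiemannInt pr = fst v) /\
  (exists pr : Riemann_integrable (fun x => snd (h x)) a b, RiemannInt pr = snd v).

Definition CImpInt (h : R -> CC) (a : R) (v : CC) : Prop :=
  (forall b, a <= b -> exists vb, CRInt h a b vb) /\
  forall eps, 0 < eps -> exists M, forall b vb, M <= b -> a <= b -> CRInt h a b vb ->
    Cnorm (Csub vb v) < eps.

Definition cint (h : R -> CC) (a b : R) : CC := epsilon C_inhabited (CRInt h a b).
Definition cimpint (h : R -> CC) (a : R) : CC := epsilon C_inhabited (CImpInt h a).

Definition euler_gamma : R :=
  epsilon (inhabits 0)
    (Un_cv (fun n => sum_f_R0 (fun j => / INR (S j)) n - ln (INR (S n)))).

Definition admissible (om : list CC) (lam : R) : Prop :=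
  0 < lam /\ forall o, In o om -> lam < Cnorm (Cmul (RtoC (2 * PI)) (Cinv o)).

(** * P_r(k, w; omega), for the radius lam.
   The integral over I(lam, infinity) is written out along its parametrization:
   - incoming half-line t = x, x from +infinity to lam, log t = ln x;
   - circle t = lam e^{i theta}, theta in [0, 2 pi], log t = ln lam + i theta,
     dt = i lam e^{i theta} d theta;
   - outgoing half-line t = x, x from lam to +infinity, log t = ln x + 2 pi i. *)
Definition P_integrand (om : list CC) (k : Z) (w t : CC) : CC :=
  Cmul (Cmul (f_omega om t) (Cexp (Copp (Cmul w t)))) (Cpowz t (- k - 1)%Z).

Definition contour_int (lam : R) (om : list CC) (k : Z) (w : CC) : CC :=
  let g := P_integrand om k w in
  let incoming := Copp (cimpint (fun x => Cmul (g (RtoC x)) (RtoC (ln x))) lam) in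
  let circle := cint (fun th =>
       let t := Cmul (RtoC lam) (Cexp (0, th)) in
       Cmul (Cmul (g t) (ln lam, th)) (Cmul Ci t)) 0 (2 * PI) in
  let outgoing := cimpint (fun x => Cmul (g (RtoC x)) (ln x, 2 * PI)) lam in
  Cadd incoming (Cadd circle outgoing).

Definition Pfun (lam : R) (om : list CC) (k : Z) (w : CC) : CC :=
  Cadd (Cmul (Cinv (Cmul (RtoC (2 * PI)) Ci)) (contour_int lam om k w))
       (Cmul (euler_gamma, - PI) (abern k w om)).

Definition in_sector (delta : R) (w : CC) : Prop :=
  0 < Re w /\ Rabs (atan (Im w / Re w)) <= PI / 2 - delta.

(* Main.v *)
(** Near [0] write [f_al t e^(-at)] as its Laurent polynomial [sum_(N <= r+k) a_N t^N] plus a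
    remainder [O(t^(r+k+1))]. Multiplied by [f_om t e^(-wt) t^(-k-1)], the monomial [a_N t^N] yields
    the integrand of [a_N P_r(k - N, w)], and the [a_(r,k)]-terms match exactly, being a Cauchy
    product. What is left is the contour integral of [D t e^(-wt) log t], where [D] does not
    depend on [w], is bounded near [0] and grows at most exponentially on the half-line. As
    contour integrals do not depend on the radius, let the radius tend to [0]: the circle disappears
    and the jump [2 pi i] of the logarithm leaves [2 pi i] times the Laplace transform of [D],
    which is [O(1 / Re w)], hence [O(1 / |w|)] in the sector. *)

(* The Bernoulli polynomials and the integrals are [epsilon] choices, so existence and uniqueness
   must be settled before they can be computed with. For the coefficients this is done through
   [expandable], a remainder bound uniform in the order: it follows from mere pointwise convergence
   of a Laurent series, is stable under products and reciprocals, and determines the coefficients.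
   For the half-line integrals existence comes from exponential decay; a power of [t] and the
   logarithm are each bounded crudely by a multiple of [e^x], at the price of one unit of [Re w],
   which is affordable because [Re w] is large at the far end of the sector.

   Independence of the radius is obtained by differentiating the circle integral with respect to the
   radius, so that only real calculus is needed. In the final limit the order of choices matters:
   the bounds on [D] are fixed before [w], the radius after [w], so that a factor [e^|w|] on the
   circle does no harm. *)
From Coquelicot Require Import Coquelicot.
From Stdlib Require Import Reals Lra Lia ZArith List ClassicalEpsilon FunctionalExtensionality.
Require Import Defs.
Open Scope R_scope.

(** * Complex arithmetic *)

Declare Scope CC_scope.
Delimit Scope CC_scope with CC.
Bind Scope CC_scope with CC.
Local Infix "+" := Cadd : CC_scope.
Local Infix "-" := Csub : CC_scope.
Local Infix "*" := Cmul : CC_scope.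
Local Notation "- z" := (Copp z) : CC_scope.
Local Notation "/ z" := (Cinv z) : CC_scope.

Lemma CC_eq (z u : CC) : fst z = fst u -> snd z = snd u -> z = u.
Proof. destruct z, u; simpl; intros; subst; reflexivity. Qed.

Lemma CC_ring_theory : ring_theory C0 C1 Cadd Cmul Csub Copp (@eq CC).
Proof.
  constructor; intros; try reflexivity; apply CC_eq; simpl; ring.
Qed.
Add Ring CC_ring : CC_ring_theory.

Lemma C1_neq_C0 : C1 <> C0.
Proof. unfold C0, C1; intros H; injection H; lra. Qed.

Lemma Cinv_l (z : CC) : z <> C0 -> (/ z * z)%CC = C1.
Proof. exact (Complex.Cinv_l z). Qed.

Lemma Cinv_r (z : CC) : z <> C0 -> (z * / z)%CC = C1.
Proof. exact (Complex.Cinv_r z). Qed.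

Lemma Cmul_neq_0 (z u : CC) : z <> C0 -> u <> C0 -> (z * u)%CC <> C0.
Proof. exact (Complex.Cmult_neq_0 z u). Qed.

Lemma Cinv_0 : (/ C0)%CC = C0.
Proof. unfold Cinv, C0; simpl. unfold Rdiv. f_equal; ring. Qed.

Lemma Cinv_unique (z u : CC) : (z * u)%CC = C1 -> u = (/ z)%CC.
Proof.
  intros H. assert (Hz : z <> C0).
  { intros E. apply C1_neq_C0. rewrite <- H, E. ring. }
  transitivity ((/ z * z) * u)%CC; [rewrite (Cinv_l z Hz); ring|].
  transitivity (/ z * (z * u))%CC; [ring|]. rewrite H. ring.
Qed.

(** Also true when [z] or [u] is [C0], because [Cinv C0 = C0]. *)
Lemma Cinv_mul (z u : CC) : (/ (z * u))%CC = (/ z * / u)%CC.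
Proof.
  destruct (excluded_middle_informative (z = C0)) as [->|Hz].
  { replace (C0 * u)%CC with C0 by ring. rewrite Cinv_0. ring. }
  destruct (excluded_middle_informative (u = C0)) as [->|Hu].
  { replace (z * C0)%CC with C0 by ring. rewrite Cinv_0. ring. }
  symmetry. apply Cinv_unique.
  transitivity ((/ z * z) * (/ u * u))%CC; [ring|].
  rewrite !Cinv_l by assumption. ring.
Qed.

Lemma Cinv_inv (z : CC) : (/ / z)%CC = z.
Proof.
  destruct (excluded_middle_informative (z = C0)) as [->|Hz].
  { rewrite !Cinv_0. reflexivity. }
  symmetry. apply Cinv_unique, Cinv_l, Hz.
Qed.

Lemma RtoC_neq_0 (x : R) : x <> 0 -> RtoC x <> C0.
Proof. intros Hx H; injection H; exact Hx. Qed.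

Lemma Cnorm_mul (z u : CC) : Cnorm (z * u)%CC = Cnorm z * Cnorm u.
Proof. exact (Cmod_mult z u). Qed.

Lemma Cnorm_add (z u : CC) : Cnorm (z + u)%CC <= Cnorm z + Cnorm u.
Proof. exact (Cmod_triangle z u). Qed.

Lemma Cnorm_opp (z : CC) : Cnorm (- z)%CC = Cnorm z.
Proof. exact (Cmod_opp z). Qed.

Lemma Cnorm_sub (z u : CC) : Cnorm (z - u)%CC <= Cnorm z + Cnorm u.
Proof. unfold Csub. rewrite <- (Cnorm_opp u). apply Cnorm_add. Qed.

Lemma Cnorm_sub_sym (z u : CC) : Cnorm (z - u)%CC = Cnorm (u - z)%CC.
Proof. rewrite <- Cnorm_opp. f_equal. ring. Qed.

Lemma Cnorm_ge_0 (z : CC) : 0 <= Cnorm z.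
Proof. exact (Cmod_ge_0 z). Qed.

Lemma Cnorm_0 : Cnorm C0 = 0.
Proof. exact Cmod_0. Qed.

Lemma Cnorm_1 : Cnorm C1 = 1.
Proof. exact Cmod_1. Qed.

Lemma Cnorm_gt_0 (z : CC) : z <> C0 -> 0 < Cnorm z.
Proof. exact (proj1 (Cmod_gt_0 z)). Qed.

Lemma Cnorm_eq_0 (z : CC) : Cnorm z = 0 -> z = C0.
Proof. exact (Cmod_eq_0 z). Qed.

Lemma Cnorm_inv (z : CC) : Cnorm (/ z)%CC = / Cnorm z.
Proof.
  destruct (excluded_middle_informative (z = C0)) as [->|Hz].
  { rewrite Cinv_0, Cnorm_0, Rinv_0. reflexivity. }
  exact (Cmod_inv z Hz).
Qed.

Lemma Cnorm_RtoC (x : R) : Cnorm (RtoC x) = Rabs x.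
Proof. exact (Cmod_R x). Qed.

Lemma Cnorm_fst (z : CC) : Rabs (fst z) <= Cnorm z.
Proof. eapply Rle_trans; [apply Rmax_l | apply (Rmax_Cmod z)]. Qed.

Lemma Cnorm_snd (z : CC) : Rabs (snd z) <= Cnorm z.
Proof. eapply Rle_trans; [apply Rmax_r | apply (Rmax_Cmod z)]. Qed.

Lemma Cnorm_Ci : Cnorm Ci = 1.
Proof.
  unfold Cnorm, Ci; simpl. replace (0 * (0 * 1) + 1 * (1 * 1)) with 1 by ring.
  apply sqrt_1.
Qed.

Lemma Cnorm_le_sum (z : CC) : Cnorm z <= Rabs (fst z) + Rabs (snd z).
Proof.
  replace z with (RtoC (fst z) + Ci * RtoC (snd z))%CC at 1
    by (apply CC_eq; simpl; ring).
  eapply Rle_trans; [apply Cnorm_add|].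
  rewrite Cnorm_mul, !Cnorm_RtoC, Cnorm_Ci. lra.
Qed.

Lemma Cexp_add (z u : CC) : Cexp (z + u)%CC = (Cexp z * Cexp u)%CC.
Proof.
  unfold Cexp; apply CC_eq; simpl; rewrite exp_plus, ?cos_plus, ?sin_plus; ring.
Qed.

Lemma Cexp_0 : Cexp C0 = C1.
Proof. unfold Cexp; apply CC_eq; simpl; rewrite exp_0, ?cos_0, ?sin_0; ring. Qed.

Lemma Cnorm_exp (z : CC) : Cnorm (Cexp z) = exp (fst z).
Proof.
  unfold Cnorm, Cexp; simpl.
  replace (_ + _) with (Rsqr (exp (fst z)) * (Rsqr (sin (snd z)) + Rsqr (cos (snd z))))
    by (unfold Rsqr; ring).
  rewrite sin2_cos2, Rmult_1_r. apply sqrt_Rsqr, Rlt_le, exp_pos.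
Qed.

Lemma Cnorm_pow (z : CC) (n : nat) : Cnorm (Cpow z n) = Cnorm z ^ n.
Proof.
  induction n as [|n IH]; simpl; [apply Cnorm_1|]. rewrite Cnorm_mul, IH. reflexivity.
Qed.

Lemma Cpow_neq_0 (z : CC) (n : nat) : z <> C0 -> Cpow z n <> C0.
Proof.
  intros Hz; induction n as [|n IH]; simpl; [apply C1_neq_C0|]. now apply Cmul_neq_0.
Qed.

Lemma Cpow_add (z : CC) (m n : nat) : Cpow z (m + n) = (Cpow z m * Cpow z n)%CC.
Proof. induction m as [|m IH]; simpl; [ring|]. rewrite IH. ring. Qed.

Lemma Cpow_mul (z u : CC) (n : nat) : Cpow (z * u)%CC n = (Cpow z n * Cpow u n)%CC.
Proof. induction n as [|n IH]; simpl; [ring|]. rewrite IH. ring. Qed.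

(** Integer exponents are treated as differences of natural numbers; the powers then become atoms
    over a common denominator, on which [ring] can work. *)
Lemma Cpowz_diff (z : CC) (m n : nat) : z <> C0 ->
  Cpowz z (Z.of_nat m - Z.of_nat n) = (Cpow z m * / Cpow z n)%CC.
Proof.
  intros Hz. unfold Cpowz.
  destruct (Z.leb_spec 0 (Z.of_nat m - Z.of_nat n)) as [H|H].
  - replace m with (Z.to_nat (Z.of_nat m - Z.of_nat n) + n)%nat at 2 by lia.
    rewrite Cpow_add.
    transitivity (Cpow z (Z.to_nat (Z.of_nat m - Z.of_nat n)) * (Cpow z n * / Cpow z n))%CC; [|ring].
    rewrite Cinv_r by (now apply Cpow_neq_0). ring.
  - replace n with (Z.to_nat (- (Z.of_nat m - Z.of_nat n)) + m)%nat at 2 by lia.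
    rewrite Cpow_add, Cinv_mul.
    transitivity (/ Cpow z (Z.to_nat (- (Z.of_nat m - Z.of_nat n))) * (Cpow z m * / Cpow z m))%CC; [|ring].
    rewrite Cinv_r by (now apply Cpow_neq_0). ring.
Qed.

(** * Finite sums *)

Fixpoint csum (F : nat -> CC) (n : nat) : CC :=
  match n with O => C0 | S m => (csum F m + F m)%CC end.

(** [sumZ] and [laurent_partial] are right folds; [csum] splits off the last term, which is what
    induction on the truncation order needs. *)
Lemma fold_right_csum (F : nat -> CC) (n : nat) :
  fold_right (fun j acc => Cadd (F j) acc) C0 (seq 0 n) = csum F n.
Proof.
  assert (H : forall l z, fold_right (fun j acc => Cadd (F j) acc) z l
     = (fold_right (fun j acc => Cadd (F j) acc) C0 l + z)%CC).
  { induction l as [|j l IH]; intros z; simpl; [ring|]. rewrite (IH z). ring. }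
  induction n as [|n IH]; [reflexivity|].
  rewrite seq_S, fold_right_app, H, IH. simpl. ring.
Qed.

Lemma sumZ_csum (m n : Z) (F : Z -> CC) :
  sumZ m n F = csum (fun j => F (m + Z.of_nat j)%Z) (Z.to_nat (n - m + 1)).
Proof. apply (fold_right_csum (fun j => F (m + Z.of_nat j)%Z)). Qed.

Lemma csum_ext (F G : nat -> CC) (n : nat) :
  (forall i, (i < n)%nat -> F i = G i) -> csum F n = csum G n.
Proof.
  induction n as [|n IH]; intros H; simpl; [reflexivity|].
  rewrite IH, H by (intros; try apply H; lia). reflexivity.
Qed.

Lemma csum_add (F G : nat -> CC) (n : nat) :
  csum (fun i => F i + G i)%CC n = (csum F n + csum G n)%CC.
Proof. induction n as [|n IH]; simpl; [ring|]. rewrite IH. ring. Qed.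

Lemma csum_mul_l (z : CC) (F : nat -> CC) (n : nat) :
  csum (fun i => z * F i)%CC n = (z * csum F n)%CC.
Proof. induction n as [|n IH]; simpl; [ring|]. rewrite IH. ring. Qed.

Lemma csum_S_l (F : nat -> CC) (n : nat) :
  csum F (S n) = (F O + csum (fun i => F (S i)) n)%CC.
Proof. induction n as [|n IH]; [simpl; ring|]. simpl in *. rewrite IH. ring. Qed.

Lemma csum_norm_le (F : nat -> CC) (B : R) (n : nat) :
  (forall i, (i < n)%nat -> Cnorm (F i) <= B) -> Cnorm (csum F n) <= INR n * B.
Proof.
  induction n as [|n IH]; intros H; [simpl; rewrite Cnorm_0; lra|].
  rewrite S_INR. simpl. eapply Rle_trans; [apply Cnorm_add|].
  specialize (IH (fun i Hi => H i (Nat.lt_lt_succ_r _ _ Hi))).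
  specialize (H n (Nat.lt_succ_diag_r n)). lra.
Qed.

Lemma INR_le_pow2 (n : nat) : INR n <= 2 ^ n.
Proof.
  induction n as [|n IH]; [simpl; lra|]. rewrite S_INR. simpl.
  assert (1 <= 2 ^ n) by (apply pow_R1_Rle; lra). lra.
Qed.

(** * Power series expansions at [0] *)

(** A quantitative form of [F t = sum_n c n t^n] near [0]: the bound is uniform in [N], so it
    says at once that the expansion is asymptotic and that it converges for [q |t| <= 1/2].
    The point [t = 0] is excluded, as [F] will be of the form [t^r f t] with [f] having a pole. *)
Definition expands (F : CC -> CC) (c : nat -> CC) (M q : R) : Prop :=
  0 <= M /\ 0 < q /\
  forall N t, t <> C0 -> q * Cnorm t <= / 2 ->
    Cnorm (F t - csum (fun n => c n * Cpow t n)%CC N)%CC <= M * (q * Cnorm t) ^ N.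

Definition expandable (F : CC -> CC) (c : nat -> CC) : Prop :=
  exists M q, expands F c M q.

Lemma expands_weaken F c M q M' q' :
  expands F c M q -> M <= M' -> q <= q' -> expands F c M' q'.
Proof.
  intros (HM & Hq & H) HM' Hq'. split; [lra|]. split; [lra|].
  intros N t Ht Htq.
  assert (Hle : q * Cnorm t <= q' * Cnorm t)
    by (apply Rmult_le_compat_r; [apply Cnorm_ge_0 | lra]).
  assert (H0 : 0 <= q * Cnorm t) by (apply Rmult_le_pos; [lra | apply Cnorm_ge_0]).
  eapply Rle_trans; [apply H; [assumption | lra]|].
  apply Rmult_le_compat; [lra | now apply pow_le | lra | apply pow_incr; lra].
Qed.

Lemma expandable_ext F G c d :
  (forall t, t <> C0 -> F t = G t) -> (forall n, c n = d n) ->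
  expandable F c -> expandable G d.
Proof.
  intros E Ec (M & q & HM & Hq & H). exists M, q. split; [lra|]. split; [lra|].
  intros N t Ht Htq. rewrite <- E by assumption.
  rewrite (csum_ext _ (fun n => c n * Cpow t n)%CC) by (intros; now rewrite Ec).
  now apply H.
Qed.

(** The term [c n t^n] is the difference of the remainders of orders [n] and [n + 1]. It is
    evaluated at [|t| = 1/(2q)], the largest radius at which the remainder bounds hold. *)
Lemma expands_coef F c M q n : expands F c M q -> Cnorm (c n) <= 2 * M * q ^ n.
Proof.
  intros (HM & Hq & H).
  set (t := RtoC (/ (2 * q))).
  assert (Hp : 0 < / (2 * q)) by (apply Rinv_0_lt_compat; lra).
  assert (Ht : t <> C0) by (apply RtoC_neq_0; lra).
  assert (Hn : Cnorm t = / (2 * q)) by (unfold t; rewrite Cnorm_RtoC; apply Rabs_pos_eq; lra).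
  assert (Hqt : q * Cnorm t = / 2) by (rewrite Hn; field; lra).
  assert (Htq : q * Cnorm t <= / 2) by lra.
  pose proof (H n t Ht Htq) as H1. pose proof (H (S n) t Ht Htq) as H2.
  set (f := fun n => (c n * Cpow t n)%CC) in *.
  assert (E : f n = ((F t - csum f n) - (F t - csum f (S n)))%CC) by (simpl; ring).
  assert (Hb : Cnorm (f n) <= 2 * M * (q * Cnorm t) ^ n).
  { rewrite E. eapply Rle_trans; [apply Cnorm_sub|].
    assert (M * (q * Cnorm t) ^ S n <= M * (q * Cnorm t) ^ n).
    { apply Rmult_le_compat_l; [lra|]. rewrite Hqt. simpl.
      assert (0 < (/ 2) ^ n) by (apply pow_lt; lra). lra. }
    lra. }
  unfold f in Hb. rewrite Cnorm_mul, Cnorm_pow, Rpow_mult_distr in Hb.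
  assert (0 < Cnorm t ^ n) by (apply pow_lt; rewrite Hn; lra).
  apply Rmult_le_reg_r with (Cnorm t ^ n); [assumption|]. lra.
Qed.

(** Once the lower coefficients agree, [(c n - d n) t^n] is a difference of two remainders of order
    [n + 1], hence [|c n - d n| <= K |t|] for all small [t]. *)
Lemma expandable_unique F c d n : expandable F c -> expandable F d -> c n = d n.
Proof.
  intros (M1 & q1 & H1) (M2 & q2 & H2).
  set (M := Rmax M1 M2). set (q := Rmax q1 q2).
  assert (Hc : expands F c M q)
    by (eapply expands_weaken; [exact H1 | apply Rmax_l | apply Rmax_l]).
  assert (Hd : expands F d M q)
    by (eapply expands_weaken; [exact H2 | apply Rmax_r | apply Rmax_r]).
  clearbody M q. clear H1 H2 M1 q1 M2 q2.
  destruct Hc as (HM & Hq & Hc), Hd as (_ & _ & Hd).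
  induction n as [n IH] using (well_founded_induction lt_wf).
  assert (E : (c n - d n)%CC = C0).
  { apply Cnorm_eq_0, Rle_antisym; [|apply Cnorm_ge_0].
    apply Rnot_lt_le. intros Hpos.
    set (K := 2 * M * q ^ S n).
    assert (HK : 0 <= K) by (apply Rmult_le_pos; [lra | apply pow_le; lra]).
    (* The first bound keeps [x] in the range of both expansions, the second makes [K x] at most
       half of [|c n - d n|]; [K + 1] replaces [K], which may be 0. *)
    set (x := Rmin (/ (2 * q)) (Cnorm (c n - d n)%CC / (2 * (K + 1)))).
    assert (Hx : 0 < x).
    { apply Rmin_glb_lt; [apply Rinv_0_lt_compat; lra|].
      apply Rdiv_lt_0_compat; lra. }
    assert (Hx1 : q * x <= / 2).
    { replace (/ 2) with (q * / (2 * q)) by (field; lra).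
      apply Rmult_le_compat_l; [lra | apply Rmin_l]. }
    assert (Hx2 : K * x <= Cnorm (c n - d n)%CC / 2).
    { apply Rle_trans with ((K + 1) * (Cnorm (c n - d n)%CC / (2 * (K + 1)))).
      - apply Rmult_le_compat; [lra | lra | lra | apply Rmin_r].
      - right. field. lra. }
    assert (Hn : Cnorm (RtoC x) = x) by (rewrite Cnorm_RtoC; apply Rabs_pos_eq; lra).
    assert (Ht : RtoC x <> C0) by (apply RtoC_neq_0; lra).
    pose proof (Hc (S n) (RtoC x) Ht ltac:(rewrite Hn; lra)) as B1.
    pose proof (Hd (S n) (RtoC x) Ht ltac:(rewrite Hn; lra)) as B2.
    rewrite Hn in B1, B2.
    assert (Es : ((c n - d n) * Cpow (RtoC x) n)%CC
       = ((F (RtoC x) - csum (fun n => d n * Cpow (RtoC x) n)%CC (S n))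
          - (F (RtoC x) - csum (fun n => c n * Cpow (RtoC x) n)%CC (S n)))%CC).
    { simpl. rewrite (csum_ext (fun n => c n * Cpow (RtoC x) n)%CC (fun n => d n * Cpow (RtoC x) n)%CC n)
        by (intros i Hi; now rewrite (IH i Hi)).
      ring. }
    assert (B : Cnorm ((c n - d n) * Cpow (RtoC x) n)%CC <= 2 * M * (q * x) ^ S n).
    { rewrite Es. eapply Rle_trans; [apply Cnorm_sub|]. lra. }
    rewrite Cnorm_mul, Cnorm_pow, Hn in B.
    replace (2 * M * (q * x) ^ S n) with (K * x * x ^ n) in B
      by (unfold K; rewrite Rpow_mult_distr; simpl; ring).
    apply Rmult_le_reg_r in B; [lra | now apply pow_lt]. }
  transitivity ((c n - d n) + d n)%CC; [ring|]. rewrite E. ring.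
Qed.

(** * Cauchy products *)

Definition conv (c d : nat -> CC) (n : nat) : CC :=
  csum (fun i => c i * d (n - i)%nat)%CC (S n).

(** Both sides run over the triangle [i + j < N], once by diagonals and once by columns. *)
Lemma csum_conv (c d : nat -> CC) (t : CC) (N : nat) :
  csum (fun n => conv c d n * Cpow t n)%CC N
  = csum (fun i => (c i * Cpow t i) * csum (fun j => d j * Cpow t j) (N - i))%CC N.
Proof.
  induction N as [|N IH]; [reflexivity|]. cbn [csum]. rewrite IH.
  rewrite (csum_ext (fun i => (c i * Cpow t i) * csum (fun j => d j * Cpow t j) (S N - i))%CC
     (fun i => (c i * Cpow t i) * csum (fun j => d j * Cpow t j) (N - i)
               + Cpow t N * (c i * d (N - i)%nat))%CC).
  2: { intros i Hi. replace (S N - i)%nat with (S (N - i)) by lia. simpl.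
       replace (Cpow t N) with (Cpow t i * Cpow t (N - i))%CC
         by (rewrite <- Cpow_add; f_equal; lia).
       ring. }
  rewrite csum_add, csum_mul_l. unfold conv.
  replace (S N - N)%nat with 1%nat by lia. simpl.
  replace (N - N)%nat with O by lia. ring.
Qed.

(** Only a growth bound is asked of [c], not that it expands a function: for reciprocals the lemma
    is applied before the coefficients are known to expand anything. Each of the [N] columns misses
    a remainder of [G] of order [N - i], which together with [q^i |t|^i] gives the same power
    [(q |t|)^N]. *)
Lemma csum_tail_bound (c d : nat -> CC) (G : CC -> CC) (t : CC) (M A q : R) (N : nat) :
  0 <= M -> 0 <= A -> 0 < q ->
  (forall i, Cnorm (c i) <= A * q ^ i) ->
  (forall n, Cnorm (G t - csum (fun j => d j * Cpow t j)%CC n)%CC <= M * (q * Cnorm t) ^ n) ->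
  Cnorm (csum (fun i => (c i * Cpow t i) * G t)%CC N
         - csum (fun n => conv c d n * Cpow t n)%CC N)%CC
  <= INR N * (A * M * (q * Cnorm t) ^ N).
Proof.
  intros HM HA Hq Hc HG. rewrite csum_conv.
  replace (_ - _)%CC with
    (csum (fun i => (c i * Cpow t i) * (G t - csum (fun j => d j * Cpow t j) (N - i)))%CC N).
  2: { unfold Csub. rewrite (csum_ext _ (fun i => (c i * Cpow t i) * G t
          + (- C1) * ((c i * Cpow t i) * csum (fun j => d j * Cpow t j) (N - i)))%CC)
         by (intros; ring).
       rewrite csum_add, csum_mul_l. ring. }
  apply csum_norm_le. intros i Hi.
  rewrite !Cnorm_mul, Cnorm_pow.
  replace (A * M * (q * Cnorm t) ^ N)
    with ((A * q ^ i) * Cnorm t ^ i * (M * (q * Cnorm t) ^ (N - i))).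
  2: { replace ((q * Cnorm t) ^ N) with ((q * Cnorm t) ^ i * (q * Cnorm t) ^ (N - i))
         by (rewrite <- pow_add; f_equal; lia).
       rewrite (Rpow_mult_distr q (Cnorm t) i). ring. }
  assert (0 <= Cnorm t ^ i) by (apply pow_le, Cnorm_ge_0).
  apply Rmult_le_compat; [|apply Cnorm_ge_0| |apply HG].
  - apply Rmult_le_pos; [apply Cnorm_ge_0 | assumption].
  - apply Rmult_le_compat_r; [assumption | apply Hc].
Qed.

(** With [S1], [S2] the partial sums of [F] and of the product,
    [F G - S2 = (F - S1) G + (G S1 - S2)]; the second term is the tail estimated by
    [csum_tail_bound]. *)
Lemma expandable_mul F G c d :
  expandable F c -> expandable G d -> expandable (fun t => F t * G t)%CC (conv c d).
Proof.
  intros (M1 & q1 & H1) (M2 & q2 & H2).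
  set (M := Rmax M1 M2). set (q := Rmax q1 q2).
  assert (Hc : expands F c M q)
    by (eapply expands_weaken; [exact H1 | apply Rmax_l | apply Rmax_l]).
  assert (Hd : expands G d M q)
    by (eapply expands_weaken; [exact H2 | apply Rmax_r | apply Rmax_r]).
  clearbody M q. clear H1 H2 M1 q1 M2 q2.
  pose proof (fun n => expands_coef F c M q n Hc) as Hcoef.
  destruct Hc as (HM & Hq & Hc), Hd as (_ & _ & Hd).
  (* The tail bound carries a factor [N]; doubling [q] provides [2^N], which absorbs it through
     [1 + 2 N <= 2 * 2^N]. *)
  exists (2 * (M * M)), (2 * q). split; [nra|]. split; [lra|].
  intros N t Ht Htq. pose proof (Cnorm_ge_0 t) as Hn.
  assert (Hs : 0 <= q * Cnorm t) by (apply Rmult_le_pos; lra).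
  set (S1 := csum (fun n => c n * Cpow t n)%CC N).
  set (S2 := csum (fun n => conv c d n * Cpow t n)%CC N).
  pose proof (csum_tail_bound c d G t M (2 * M) q N HM ltac:(lra) Hq Hcoef
    (fun n => Hd n t Ht ltac:(lra))) as Hb.
  fold S2 in Hb.
  assert (E : csum (fun i => c i * Cpow t i * G t)%CC N = (G t * S1)%CC).
  { unfold S1. rewrite <- csum_mul_l. apply csum_ext. intros; ring. }
  rewrite E in Hb.
  replace (F t * G t - S2)%CC with ((F t - S1) * G t + (G t * S1 - S2))%CC by ring.
  eapply Rle_trans; [apply Cnorm_add|]. rewrite Cnorm_mul.
  assert (HG : Cnorm (G t) <= M).
  { pose proof (Hd O t Ht ltac:(lra)) as B. simpl in B.
    replace (G t - C0)%CC with (G t) in B by ring. lra. }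
  assert (HF : Cnorm (F t - S1)%CC <= M * (q * Cnorm t) ^ N) by (apply Hc; [assumption | lra]).
  assert (HP : 0 <= (q * Cnorm t) ^ N) by (now apply pow_le).
  assert (HFG : Cnorm (F t - S1)%CC * Cnorm (G t) <= M * (q * Cnorm t) ^ N * M)
    by (apply Rmult_le_compat; auto using Cnorm_ge_0).
  replace (2 * q * Cnorm t) with (2 * (q * Cnorm t)) by ring.
  rewrite (Rpow_mult_distr 2).
  assert (HN : 1 + 2 * INR N <= 2 * 2 ^ N).
  { clear. induction N as [|N IH]; [simpl; lra|]. rewrite S_INR. simpl.
    assert (1 <= 2 ^ N) by (apply pow_R1_Rle; lra). lra. }
  assert (0 <= M * M * (q * Cnorm t) ^ N) by (apply Rmult_le_pos; nra).
  nra.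
Qed.

(** * Derivatives of complex functions of a real variable, and the exponential series *)

Definition cder (h : R -> CC) (x : R) (d : CC) : Prop :=
  is_derive (fun s => fst (h s)) x (fst d) /\ is_derive (fun s => snd (h s)) x (snd d).

Lemma cder_ext h g x d : (forall s, h s = g s) -> cder h x d -> cder g x d.
Proof.
  intros E [H1 H2]; split; (eapply is_derive_ext; [intros t; rewrite <- E; reflexivity|]); assumption.
Qed.

Lemma cder_const z x : cder (fun _ => z) x C0.
Proof. split; apply (@is_derive_const R_AbsRing R_NormedModule). Qed.

Lemma cder_add h g x d e : cder h x d -> cder g x e -> cder (fun s => h s + g s)%CC x (d + e)%CC.
Proof.
  intros [H1 H2] [G1 G2]; split; simpl;
  apply (@is_derive_plus R_AbsRing R_NormedModule); assumption.
Qed.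

Lemma is_derive_Rmult (u v : R -> R) x a b : is_derive u x a -> is_derive v x b ->
  is_derive (fun s => u s * v s) x (a * v x + u x * b).
Proof.
  intros Hu Hv. apply (@is_derive_mult R_AbsRing u v x a b Hu Hv). exact Rmult_comm.
Qed.

Lemma cder_mul h g x d e : cder h x d -> cder g x e ->
  cder (fun s => h s * g s)%CC x (d * g x + h x * e)%CC.
Proof.
  intros [H1 H2] [G1 G2]; split.
  - replace (fst _) with (fst d * fst (g x) + fst (h x) * fst e
      - (snd d * snd (g x) + snd (h x) * snd e)) by (simpl; ring).
    apply (@is_derive_minus R_AbsRing R_NormedModule (fun s => fst (h s) * fst (g s))
      (fun s => snd (h s) * snd (g s))); now apply is_derive_Rmult.
  - replace (snd _) with (fst d * snd (g x) + fst (h x) * snd e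
      + (snd d * fst (g x) + snd (h x) * fst e)) by (simpl; ring).
    apply (@is_derive_plus R_AbsRing R_NormedModule (fun s => fst (h s) * snd (g s))
      (fun s => snd (h s) * fst (g s))); now apply is_derive_Rmult.
Qed.

Lemma cder_exp h x d : cder h x d -> cder (fun s => Cexp (h s)) x (Cexp (h x) * d)%CC.
Proof.
  intros [H1 H2].
  pose proof (is_derive_comp exp (fun s => fst (h s)) x _ _ (is_derive_exp _) H1) as He.
  pose proof (is_derive_comp cos (fun s => snd (h s)) x _ _ (is_derive_cos _) H2) as Hc.
  pose proof (is_derive_comp sin (fun s => snd (h s)) x _ _ (is_derive_sin _) H2) as Hs.
  unfold scal, mult in He, Hc, Hs; simpl in He, Hc, Hs; unfold mult in He, Hc, Hs; simpl in He, Hc, Hs.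
  split; simpl.
  - evar_last; [exact (is_derive_Rmult _ _ _ _ _ He Hc)|].
    match goal with |- ?a = ?b => change (@eq R a b) end; cbv beta; ring.
  - evar_last; [exact (is_derive_Rmult _ _ _ _ _ He Hs)|].
    match goal with |- ?a = ?b => change (@eq R a b) end; cbv beta; ring.
Qed.

Lemma cder_RtoC (f : R -> R) x l : is_derive f x l -> cder (fun s => RtoC (f s)) x (RtoC l).
Proof.
  intros H; split; simpl; [exact H | apply (@is_derive_const R_AbsRing R_NormedModule)].
Qed.

(** The mean value theorem fails for complex values; it is applied to the two coordinates
    separately, which costs the factor 2. *)
Lemma cder_mean_value h d (B : R) :
  (forall s, 0 <= s <= 1 -> cder h s (d s)) -> (forall s, 0 <= s <= 1 -> Cnorm (d s) <= B) ->
  forall s, 0 <= s <= 1 -> Cnorm (h s - h 0)%CC <= 2 * B.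
Proof.
  intros H Hd s Hs.
  assert (K : forall p : CC -> R, (forall z, Rabs (p z) <= Cnorm z) ->
    (forall x, 0 <= x <= 1 -> is_derive (fun s => p (h s)) x (p (d x))) ->
    Rabs (p (h s) - p (h 0)) <= B).
  { intros p Hp Hder.
    destruct (MVT_gen (fun s => p (h s)) 0 s (fun x => p (d x))) as (c & Hc & E).
    - intros x Hx. rewrite Rmin_left, Rmax_right in Hx by lra. apply Hder; lra.
    - intros x Hx. rewrite Rmin_left, Rmax_right in Hx by lra.
      apply continuity_pt_filterlim, (@ex_derive_continuous R_AbsRing R_NormedModule).
      eexists; apply Hder; lra.
    - rewrite Rmin_left, Rmax_right in Hc by lra.
      rewrite E, Rabs_mult, Rminus_0_r, (Rabs_pos_eq s) by lra.
      assert (Rabs (p (d c)) <= B) by (eapply Rle_trans; [apply Hp | apply Hd; lra]).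
      pose proof (Rabs_pos (p (d c))). nra. }
  eapply Rle_trans; [apply Cnorm_le_sum|].
  pose proof (K fst Cnorm_fst (fun x Hx => proj1 (H x Hx))).
  pose proof (K snd Cnorm_snd (fun x Hx => proj2 (H x Hx))).
  unfold Csub; simpl. unfold Rminus in *. lra.
Qed.

Lemma exp_le (x y : R) : x <= y -> exp x <= exp y.
Proof. intros [H| ->]; [apply Rlt_le; now apply exp_increasing | apply Rle_refl]. Qed.

(** Along [s] in [[0, 1]], the remainder of order [N + 1] of [e^(sz)] vanishes at [s = 0] and has
    derivative [z] times the remainder of order [N]. Each induction step therefore contributes
    [2 |z|]; the factorials, which would sharpen the bound, are given up. *)
Lemma Cexp_taylor (z : CC) (N : nat) :
  Cnorm (Cexp z - csum (fun n => RtoC (/ INR (fact n)) * Cpow z n)%CC N)%CC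
  <= exp (Cnorm z) * (2 * Cnorm z) ^ N.
Proof.
  set (T := fun N s => csum (fun n => RtoC (s ^ n / INR (fact n)) * Cpow z n)%CC N).
  assert (HT : forall N s, cder (T (S N)) s (z * T N s)%CC).
  { clear N. induction N as [|N IH]; intros s.
    - replace (z * T O s)%CC with C0 by (unfold T; simpl; ring).
      eapply cder_ext; [|apply (cder_const C1)].
      intros u. unfold T; simpl. apply CC_eq; simpl; field.
    - replace (z * T (S N) s)%CC with
        (z * T N s + (RtoC (s ^ N / INR (fact N)) * Cpow z (S N) + RtoC (s ^ S N / INR (fact (S N))) * C0))%CC
        by (unfold T; simpl; ring).
      apply (cder_add (T (S N)) (fun s => RtoC (s ^ S N / INR (fact (S N))) * Cpow z (S N))%CC); [apply IH|].
      apply (cder_mul (fun s => RtoC (s ^ S N / INR (fact (S N)))) (fun _ => Cpow z (S N))); [|apply cder_const].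
      apply cder_RtoC. pose proof (INR_fact_lt_0 N).
      assert (INR (S N) <> 0) by (apply not_0_INR; lia).
      rewrite fact_simpl, mult_INR.
      set (m := INR (S N)) in *. set (f := INR (fact N)) in *.
      auto_derive; [trivial|]. change (1 * (m * s ^ N) * / (m * f) = s ^ N / f). field. split; [lra | assumption]. }
  assert (HE : forall s, cder (fun s => Cexp (RtoC s * z)%CC) s (z * Cexp (RtoC s * z))%CC).
  { intros s. replace (z * Cexp (RtoC s * z))%CC
      with (Cexp (RtoC s * z) * (RtoC 1 * z + RtoC s * C0))%CC
      by (change (RtoC 1) with C1; ring).
    apply (cder_exp (fun s => RtoC s * z)%CC), (cder_mul (fun s => RtoC s) (fun _ => z));
    [|apply cder_const]. apply (cder_RtoC (fun s => s)), (@is_derive_id R_AbsRing). }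
  assert (HR : forall N s, 0 <= s <= 1 ->
    Cnorm (Cexp (RtoC s * z) - T N s)%CC <= exp (Cnorm z) * (2 * Cnorm z) ^ N).
  { clear N. induction N as [|N IH]; intros s Hs.
    - unfold T; simpl. replace (_ - C0)%CC with (Cexp (RtoC s * z)) by ring.
      rewrite Cnorm_exp, Rmult_1_r. apply exp_le. simpl.
      pose proof (Cnorm_fst z) as B. pose proof (Cnorm_ge_0 z).
      apply Rabs_le_between in B. nra.
    - replace (Cexp (RtoC s * z) - T (S N) s)%CC with
        ((Cexp (RtoC s * z) - T (S N) s) - (Cexp (RtoC 0 * z) - T (S N) 0))%CC.
      2: { assert (E0 : T (S N) 0 = C1).
           { unfold T. rewrite csum_S_l.
             rewrite (csum_ext _ (fun _ => C0 * C0)%CC), csum_mul_l.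
             - simpl. apply CC_eq; simpl; field.
             - intros i _. replace (RtoC (0 ^ S i / INR (fact (S i)))) with C0; [ring|].
               unfold RtoC, C0. f_equal. simpl. unfold Rdiv. ring. }
           rewrite E0. replace (RtoC 0 * z)%CC with C0 by (change (RtoC 0) with C0; ring).
           rewrite Cexp_0. ring. }
      replace (exp (Cnorm z) * (2 * Cnorm z) ^ S N)
        with (2 * (Cnorm z * (exp (Cnorm z) * (2 * Cnorm z) ^ N))) by (simpl; ring).
      apply (cder_mean_value (fun s => Cexp (RtoC s * z) - T (S N) s)%CC
               (fun s => z * (Cexp (RtoC s * z) - T N s))%CC); [| |assumption].
      + intros x _.
        replace (z * (Cexp (RtoC x * z) - T N x))%CC with
          (z * Cexp (RtoC x * z) + (C0 * T (S N) x + - C1 * (z * T N x)))%CC by ring.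
        eapply cder_ext; [|exact (cder_add _ _ _ _ _ (HE x)
            (cder_mul _ _ _ _ _ (cder_const (- C1)%CC x) (HT N x)))].
        intros u; simpl. ring.
      + intros x Hx. rewrite Cnorm_mul. apply Rmult_le_compat_l; [apply Cnorm_ge_0 | now apply IH]. }
  specialize (HR N 1 ltac:(lra)).
  replace (RtoC 1 * z)%CC with z in HR by (change (RtoC 1) with C1; ring).
  replace (csum _ N) with (T N 1); [exact HR|].
  unfold T. apply csum_ext. intros i _. rewrite pow1. unfold Rdiv. rewrite Rmult_1_l. reflexivity.
Qed.

Lemma expandable_exp (w : CC) :
  expandable (fun t => Cexp (w * t)%CC) (fun n => RtoC (/ INR (fact n)) * Cpow w n)%CC.
Proof.
  (* The summand 1 keeps [q] positive when [w = 0]; [q |t| <= 1/2] then gives [|w t| <= 1], so that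
     [exp |w t|] is at most [exp 1]. *)
  exists (exp 1), (2 * (Cnorm w + 1)). pose proof (Cnorm_ge_0 w).
  split; [apply Rlt_le, exp_pos|]. split; [lra|].
  intros N t Ht Htq. pose proof (Cnorm_ge_0 t).
  rewrite (csum_ext _ (fun n => RtoC (/ INR (fact n)) * Cpow (w * t) n)%CC)
    by (intros; rewrite Cpow_mul; ring).
  eapply Rle_trans; [apply Cexp_taylor|]. rewrite Cnorm_mul.
  apply Rmult_le_compat; [apply Rlt_le, exp_pos | apply pow_le; nra | apply exp_le; nra |].
  apply pow_incr. nra.
Qed.

Lemma expandable_const (z : CC) :
  expandable (fun _ => z) (fun n => match n with O => z | _ => C0 end).
Proof.
  exists (Cnorm z), 1. pose proof (Cnorm_ge_0 z). split; [lra|]. split; [lra|].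
  intros [|N] t Ht Htq.
  - simpl. replace (z - C0)%CC with z by ring. lra.
  - rewrite csum_S_l, (csum_ext _ (fun _ => C0 * C0)%CC), csum_mul_l by (intros; ring).
    simpl. replace (z - _)%CC with C0 by ring. rewrite Cnorm_0.
    apply Rmult_le_pos; [lra|]. apply (pow_le (1 * Cnorm t) (S N)).
    pose proof (Cnorm_ge_0 t). lra.
Qed.

Lemma expandable_add F G c d : expandable F c -> expandable G d ->
  expandable (fun t => F t + G t)%CC (fun n => c n + d n)%CC.
Proof.
  intros (M1 & q1 & H1) (M2 & q2 & H2).
  set (M := Rmax M1 M2). set (q := Rmax q1 q2).
  assert (Hc : expands F c M q)
    by (eapply expands_weaken; [exact H1 | apply Rmax_l | apply Rmax_l]).
  assert (Hd : expands G d M q)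
    by (eapply expands_weaken; [exact H2 | apply Rmax_r | apply Rmax_r]).
  destruct Hc as (HM & Hq & Hc), Hd as (_ & _ & Hd).
  exists (2 * M), q. split; [lra|]. split; [lra|]. intros N t Ht Htq.
  rewrite (csum_ext _ (fun n => c n * Cpow t n + d n * Cpow t n)%CC) by (intros; ring).
  rewrite csum_add.
  replace (_ - _)%CC with ((F t - csum (fun n => c n * Cpow t n) N)
    + (G t - csum (fun n => d n * Cpow t n) N))%CC by ring.
  eapply Rle_trans; [apply Cnorm_add|].
  specialize (Hc N t Ht Htq). specialize (Hd N t Ht Htq). lra.
Qed.

Lemma expandable_scale z F c : expandable F c ->
  expandable (fun t => z * F t)%CC (fun n => z * c n)%CC.
Proof.
  intros (M & q & HM & Hq & H). exists (Cnorm z * M), q.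
  split; [apply Rmult_le_pos; [apply Cnorm_ge_0 | assumption]|]. split; [assumption|].
  intros N t Ht Htq.
  rewrite (csum_ext _ (fun n => z * (c n * Cpow t n))%CC), csum_mul_l by (intros; ring).
  replace (_ - _)%CC with (z * (F t - csum (fun n => c n * Cpow t n) N))%CC by ring.
  rewrite Cnorm_mul, Rmult_assoc. apply Rmult_le_compat_l; [apply Cnorm_ge_0 | now apply H].
Qed.

(** Meant for [1 - e^(-ot)], whose zero at the origin has to be divided out before a reciprocal can
    be taken. The remainder of order [N] of the quotient is that of order [N + 1] of [F] divided by
    [t], whence the new constant [M q]. *)
Lemma expandable_shift F c : c O = C0 -> expandable F c ->
  expandable (fun t => / t * F t)%CC (fun n => c (S n)).
Proof.
  intros H0 (M & q & HM & Hq & H). exists (M * q), q.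
  split; [apply Rmult_le_pos; lra|]. split; [assumption|].
  intros N t Ht Htq. specialize (H (S N) t Ht Htq).
  rewrite csum_S_l, H0, (csum_ext _ (fun n => t * (c (S n) * Cpow t n))%CC), csum_mul_l in H
    by (intros; simpl; ring).
  replace (_ - _)%CC with (/ t * (F t - (C0 * Cpow t 0 + t * csum (fun n => c (S n) * Cpow t n) N)))%CC.
  2: { transitivity (/ t * F t - (/ t * t) * csum (fun n => c (S n) * Cpow t n) N)%CC; [ring|].
       rewrite (Cinv_l t Ht). ring. }
  rewrite Cnorm_mul, Cnorm_inv. pose proof (Cnorm_gt_0 t Ht).
  apply Rmult_le_reg_l with (Cnorm t); [assumption|].
  rewrite <- Rmult_assoc, Rinv_r, Rmult_1_l by lra.
  eapply Rle_trans; [exact H|]. simpl. right. ring.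
Qed.

(** The coefficients [d] of the reciprocal of a series with [c 0 = 1], in reverse order
    [d n, ..., d 0], so that course-of-values recursion becomes structural. *)
Fixpoint recip_list (c : nat -> CC) (n : nat) : list CC :=
  match n with
  | O => C1 :: nil
  | S m => (- csum (fun i => nth (m - i) (recip_list c m) C0 * c (S m - i)%nat) (S m))%CC
           :: recip_list c m
  end.

Definition recip (c : nat -> CC) (n : nat) : CC := nth 0 (recip_list c n) C0.

Lemma recip_S c n : recip c (S n) = (- csum (fun i => recip c i * c (S n - i)%nat) (S n))%CC.
Proof.
  assert (H : forall k m, (k <= m)%nat -> nth (m - k) (recip_list c m) C0 = recip c k).
  { intros k m Hk. induction m as [|m IH].
    - replace k with O by lia. reflexivity.
    - destruct (Nat.eq_dec k (S m)) as [->|Hne].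
      + now rewrite Nat.sub_diag.
      + replace (S m - k)%nat with (S (m - k)) by lia. apply IH. lia. }
  unfold recip at 1. cbn [recip_list nth]. f_equal. apply csum_ext.
  intros i Hi. rewrite H by lia. reflexivity.
Qed.

Lemma conv_recip c n : c O = C1 ->
  conv (recip c) c n = match n with O => C1 | _ => C0 end.
Proof.
  intros H0. destruct n as [|n].
  - unfold conv; simpl. unfold recip; simpl. rewrite H0. ring.
  - unfold conv. cbn [csum].
    change (csum (fun i => recip c i * c (S n - i)%nat)%CC n + recip c n * c (S n - n)%nat)%CC
      with (csum (fun i => recip c i * c (S n - i)%nat)%CC (S n)).
    rewrite Nat.sub_diag, H0, recip_S. ring.
Qed.

(** The rate [p = (M + 1) q] makes the majorant of the recursion telescope: [q (p^k - q^k) + M q p^k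
    = p^(k+1) - q^(k+1)]. *)
Lemma recip_bound c M q : 0 <= M -> 0 < q -> (forall n, Cnorm (c n) <= M * q ^ n) ->
  forall n, Cnorm (recip c n) <= ((M + 1) * q) ^ n.
Proof.
  intros HM Hq Hc. set (p := (M + 1) * q). assert (Hp : 0 < p) by (unfold p; nra).
  induction n as [n IH] using (well_founded_induction lt_wf).
  destruct n as [|n]; [unfold recip; simpl; rewrite Cnorm_1; lra|].
  rewrite recip_S, Cnorm_opp.
  assert (K : forall k m, (k <= S n)%nat -> (k <= m)%nat ->
    Cnorm (csum (fun i => recip c i * c (m - i)%nat)%CC k) <= q ^ (m - k) * (p ^ k - q ^ k)).
  { induction k as [|k IHk]; intros m Hk Hm; [simpl; rewrite Cnorm_0; lra|].
    cbn [csum]. eapply Rle_trans; [apply Cnorm_add|].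
    eapply Rle_trans; [apply Rplus_le_compat; [apply IHk; lia|]|].
    { rewrite Cnorm_mul. apply Rmult_le_compat; [apply Cnorm_ge_0 | apply Cnorm_ge_0 | apply IH; lia | apply Hc]. }
    replace (m - k)%nat with (S (m - S k)) by lia. simpl. right. unfold p. ring. }
  eapply Rle_trans; [apply K; lia|]. rewrite Nat.sub_diag.
  assert (0 < q ^ S n) by (now apply pow_lt). simpl (q ^ 0). lra.
Qed.

(** With [S1] the partial sum of [recip c], [1/F - S1 = -(1/F) (S1 F - 1)]. Near 0 one has
    [|F| >= 1/2], and [S1 F - 1] is the tail of a Cauchy product whose partial sums equal 1. *)
Lemma expandable_inv F c : c O = C1 -> expandable F c -> expandable (fun t => / F t)%CC (recip c).
Proof.
  intros H0 (M & q & H).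
  pose proof (fun n => expands_coef F c M q n H) as Hcoef. destruct H as (HM & Hq & H).
  pose proof (recip_bound c (2 * M) q ltac:(lra) Hq Hcoef) as Hd.
  set (p := (2 * M + 1) * q) in *. assert (Hp : q <= p) by (unfold p; nra).
  exists (2 * M + 2), (2 * p). split; [lra|]. split; [lra|].
  intros N t Ht Htq. pose proof (Cnorm_gt_0 t Ht) as Hn.
  assert (Hqt : q * Cnorm t <= / 2) by nra.
  assert (HF : / 2 <= Cnorm (F t)).
  { pose proof (H 1%nat t Ht Hqt) as B. simpl in B. rewrite H0 in B.
    replace (C0 + C1 * C1)%CC with C1 in B by ring.
    assert (M * (q * Cnorm t * 1) <= / 2).
    { assert (M * q * Cnorm t <= p * Cnorm t) by (apply Rmult_le_compat_r; unfold p; nra). nra. }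
    pose proof (Cnorm_sub (F t) (F t - C1)%CC) as B1.
    replace (F t - (F t - C1))%CC with C1 in B1 by ring. rewrite Cnorm_1 in B1. lra. }
  assert (HF0 : F t <> C0) by (intros E; rewrite E, Cnorm_0 in HF; lra).
  assert (HFi : Cnorm (/ F t)%CC <= 2).
  { rewrite Cnorm_inv. replace 2 with (/ / 2) by field. apply Rinv_le_contravar; lra. }
  (* The empty partial sum lacks the constant term 1, so order 0 is bounded directly by
     [|1/F| <= 2]. *)
  destruct N as [|N].
  { simpl. replace (/ F t - C0)%CC with (/ F t)%CC by ring. lra. }
  set (S1 := csum (fun n => recip c n * Cpow t n)%CC (S N)).
  replace (/ F t - S1)%CC with (- (/ F t * (S1 * F t - C1)))%CC.
  2: { transitivity (/ F t - (/ F t * F t) * S1)%CC; [ring|]. rewrite (Cinv_l _ HF0). ring. }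
  rewrite Cnorm_opp, Cnorm_mul.
  assert (B : Cnorm (S1 * F t - C1)%CC <= INR (S N) * (1 * M * (p * Cnorm t) ^ S N)).
  { replace (S1 * F t)%CC with (csum (fun i => recip c i * Cpow t i * F t)%CC (S N)).
    2: { rewrite (csum_ext _ (fun i => F t * (recip c i * Cpow t i))%CC), csum_mul_l by (intros; ring).
         unfold S1. ring. }
    replace C1 with (csum (fun n => conv (recip c) c n * Cpow t n)%CC (S N)).
    2: { rewrite csum_S_l, (csum_ext _ (fun _ => C0 * C0)%CC), csum_mul_l, conv_recip by
           (try assumption; intros; rewrite conv_recip by assumption; ring). simpl. ring. }
    apply csum_tail_bound; try lra.
    - intros i. rewrite Rmult_1_l. apply Hd.
    - intros n. eapply Rle_trans; [apply H; assumption|].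
      apply Rmult_le_compat_l; [lra|]. apply pow_incr. split; [nra|].
      apply Rmult_le_compat_r; lra. }
  replace (2 * p * Cnorm t) with (2 * (p * Cnorm t)) by ring. rewrite (Rpow_mult_distr 2).
  pose proof (INR_le_pow2 (S N)) as HN. pose proof (pos_INR (S N)).
  assert (HP : 0 <= (p * Cnorm t) ^ S N) by (apply pow_le; nra).
  assert (0 <= 2 ^ S N) by (apply pow_le; lra).
  apply Rle_trans with (2 * (INR (S N) * (1 * M * (p * Cnorm t) ^ S N))).
  { apply Rmult_le_compat; auto using Cnorm_ge_0. }
  set (P := (p * Cnorm t) ^ S N) in *. set (T := 2 ^ S N) in *. set (I := INR (S N)) in *.
  assert (0 <= T * P) by (now apply Rmult_le_pos).
  assert (I * P <= T * P) by (apply Rmult_le_compat_r; assumption).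
  nra.
Qed.

(** * Laurent expansions and multiple Bernoulli polynomials *)

(** Since [1 - e^(-ot) = o t + ...], division by [o t] produces a series with constant term 1, to
    which [expandable_inv] applies; the factor [1/o] is restored at the end. *)
Lemma expandable_factor (o : CC) : o <> C0 ->
  exists c, expandable (fun t => t * / (C1 - Cexp (- (o * t))))%CC c.
Proof.
  intros Ho. set (c := fun n => ((match n with O => C1 | _ => C0 end)
     + (- C1) * (RtoC (/ INR (fact n)) * Cpow (- o) n))%CC).
  assert (H : expandable (fun t => C1 + (- C1) * Cexp ((- o) * t))%CC c).
  { apply expandable_add; [apply expandable_const|]. apply expandable_scale, expandable_exp. }
  assert (E0 : c O = C0) by (unfold c; apply CC_eq; simpl; field).
  assert (E1 : (/ o * c 1%nat)%CC = C1).
  { replace (c 1%nat) with o by (unfold c; apply CC_eq; simpl; field). now apply Cinv_l. }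
  apply (expandable_shift _ _ E0), (expandable_scale (/ o)%CC), (expandable_inv _ _ E1) in H.
  eexists. eapply expandable_ext; [| |exact (expandable_scale (/ o)%CC _ _ H)].
  - intros t Ht. cbv beta. rewrite !Cinv_mul, !Cinv_inv.
    replace (C1 + (- C1) * Cexp ((- o) * t))%CC with (C1 - Cexp (- (o * t)))%CC.
    2: { replace ((- o) * t)%CC with (- (o * t))%CC by ring. ring. }
    transitivity ((/ o * o) * (t * / (C1 - Cexp (- (o * t)))))%CC; [ring|].
    rewrite (Cinv_l o Ho). ring.
  - reflexivity.
Qed.

Lemma f_omega_cons (o : CC) (om : list CC) (t : CC) :
  f_omega (o :: om) t = (/ (C1 - Cexp (- (o * t))) * f_omega om t)%CC.
Proof. reflexivity. Qed.

Lemma f_omega_app (om al : list CC) (t : CC) :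
  f_omega (om ++ al) t = (f_omega om t * f_omega al t)%CC.
Proof.
  induction om as [|o om IH]; simpl app.
  - change (f_omega nil t) with C1. ring.
  - rewrite !f_omega_cons, IH. ring.
Qed.

Lemma expandable_f_omega (om : list CC) : (forall o, In o om -> o <> C0) ->
  exists c, expandable (fun t => Cpow t (length om) * f_omega om t)%CC c.
Proof.
  induction om as [|o om IH]; intros Hom.
  - eexists. eapply expandable_ext; [| |exact (expandable_const C1)]; [|reflexivity].
    intros t _. change (f_omega nil t) with C1. simpl. ring.
  - destruct IH as [c Hc]; [intros; apply Hom; now right|].
    destruct (expandable_factor o) as [d Hd]; [apply Hom; now left|].
    eexists. eapply expandable_ext; [| |exact (expandable_mul _ _ _ _ Hd Hc)]; [|reflexivity].
    intros t _. rewrite f_omega_cons. simpl. ring.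
Qed.

Lemma laurent_partial_csum (r : nat) (c : Z -> CC) (N : nat) (t : CC) : t <> C0 ->
  laurent_partial r c N t
  = (/ Cpow t r * csum (fun j => c (Z.of_nat j - Z.of_nat r)%Z * Cpow t j) (S N))%CC.
Proof.
  intros Ht. unfold laurent_partial.
  rewrite (fold_right_csum (fun j => Cmul (c (Z.of_nat j - Z.of_nat r)%Z) (Cpowz t (Z.of_nat j - Z.of_nat r)%Z))).
  rewrite <- csum_mul_l. apply csum_ext. intros i _. rewrite Cpowz_diff by assumption. ring.
Qed.

(** For [|t| < 1/(2q)] the remainder bound is geometric and tends to 0; dividing by [t^r] for a
    fixed [t] does not affect the convergence. *)
Lemma laurent_of_expandable (F : CC -> CC) (r : nat) (c : nat -> CC) :
  expandable (fun t => Cpow t r * F t)%CC c ->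
  laurent_expansion F r
    (fun n => if Z_lt_dec n (- Z.of_nat r) then C0 else c (Z.to_nat (n + Z.of_nat r))).
Proof.
  intros (M & q & HM & Hq & H). split.
  { intros n Hn. destruct (Z_lt_dec n (- Z.of_nat r)); [reflexivity | contradiction]. }
  exists (/ (2 * q)). split; [apply Rinv_0_lt_compat; lra|].
  intros t Ht eps Heps.
  assert (Ht0 : t <> C0) by (intros E; rewrite E, Cnorm_0 in Ht; lra).
  assert (Htq : q * Cnorm t <= / 2).
  { replace (/ 2) with (q * / (2 * q)) by (field; lra). apply Rmult_le_compat_l; lra. }
  assert (Hqt : 0 < q * Cnorm t) by (apply Rmult_lt_0_compat; lra).
  assert (HP : 0 < Cnorm t ^ r) by (apply pow_lt; lra).
  destruct (pow_lt_1_zero (q * Cnorm t) ltac:(rewrite Rabs_pos_eq; lra)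
     (eps * Cnorm t ^ r / (M + 1))) as [N0 HN0].
  { apply Rdiv_lt_0_compat; [now apply Rmult_lt_0_compat | lra]. }
  exists N0. intros N HN. rewrite laurent_partial_csum by assumption.
  specialize (H (S N) t Ht0 Htq). specialize (HN0 (S N) ltac:(lia)).
  rewrite Rabs_pos_eq in HN0 by (apply pow_le; lra).
  rewrite (csum_ext _ (fun n => c n * Cpow t n)%CC).
  2: { intros i _. destruct (Z_lt_dec _ _); [lia|].
       replace (Z.to_nat (Z.of_nat i - Z.of_nat r + Z.of_nat r)) with i by lia. reflexivity. }
  set (S1 := csum _ _) in *.
  replace (/ Cpow t r * S1 - F t)%CC with (- (/ Cpow t r * (Cpow t r * F t - S1)))%CC.
  2: { transitivity (/ Cpow t r * S1 - (/ Cpow t r * Cpow t r) * F t)%CC; [ring|].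
       rewrite Cinv_l by (now apply Cpow_neq_0). ring. }
  rewrite Cnorm_opp, Cnorm_mul, Cnorm_inv, Cnorm_pow.
  apply Rmult_lt_reg_l with (Cnorm t ^ r); [assumption|].
  rewrite <- Rmult_assoc, Rinv_r, Rmult_1_l by lra.
  eapply Rle_lt_trans; [exact H|].
  apply Rle_lt_trans with ((M + 1) * (q * Cnorm t) ^ S N).
  { apply Rmult_le_compat_r; [apply pow_le|]; lra. }
  apply Rlt_le_trans with ((M + 1) * (eps * Cnorm t ^ r / (M + 1))).
  { apply Rmult_lt_compat_l; lra. }
  right. field. lra.
Qed.

Lemma geometric_csum_bound (f : nat -> CC) (A x : R) (m n : nat) :
  0 <= x <= / 2 -> 0 <= A -> (forall i, Cnorm (f i) <= A * x ^ i) ->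
  Cnorm (csum f (m + n) - csum f m)%CC <= 2 * A * x ^ m.
Proof.
  intros Hx HA Hf.
  (* The strengthened bound is inductive: one more term requires [A x^j <= 2 A (1 - x) x^j], that is
     [x <= 1/2]. *)
  enough (H : Cnorm (csum f (m + n) - csum f m)%CC <= 2 * A * (x ^ m - x ^ (m + n))).
  { assert (0 <= x ^ (m + n)) by (apply pow_le; lra). nra. }
  induction n as [|n IH].
  - rewrite Nat.add_0_r. replace (_ - _)%CC with C0 by ring. rewrite Cnorm_0. lra.
  - replace (m + S n)%nat with (S (m + n)) by lia. cbn [csum].
    replace (_ - _)%CC with ((csum f (m + n) - csum f m) + f (m + n)%nat)%CC by ring.
    eapply Rle_trans; [apply Cnorm_add|]. specialize (Hf (m + n)%nat). simpl pow.
    assert (0 <= x ^ (m + n)) by (apply pow_le; lra).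
    assert (A * x ^ (m + n) <= 2 * A * (1 - x) * x ^ (m + n)).
    { apply Rmult_le_compat_r; [assumption|]. nra. }
    nra.
Qed.

Lemma bounded_eventually (f : nat -> R) (B : R) (N : nat) :
  (forall n, (N <= n)%nat -> f n <= B) -> exists A, 0 <= A /\ forall n, f n <= A.
Proof.
  revert B. induction N as [|N IH]; intros B H.
  - exists (Rmax 0 B). split; [apply Rmax_l|].
    intros n. eapply Rle_trans; [apply H; lia | apply Rmax_r].
  - apply (IH (Rmax B (f N))). intros n Hn.
    destruct (Nat.eq_dec n N) as [->|Hne]; [apply Rmax_r|].
    eapply Rle_trans; [apply H; lia | apply Rmax_l].
Qed.

(** Abel's argument: convergence at the single point [s = rho/2] bounds [|d n| s^n] by some [A], and
    for [|t| <= s/2] the tails are then dominated by a geometric series, uniformly in the order. *)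
Lemma expandable_of_laurent (F : CC -> CC) (r : nat) (c : Z -> CC) :
  laurent_expansion F r c ->
  expandable (fun t => Cpow t r * F t)%CC (fun n => c (Z.of_nat n - Z.of_nat r)%Z).
Proof.
  intros (_ & rho & Hrho & H).
  set (d := fun n => c (Z.of_nat n - Z.of_nat r)%Z).
  assert (Hlim : forall t, t <> C0 -> Cnorm t < rho -> forall eps, 0 < eps ->
    exists N0, forall N, (N0 <= N)%nat ->
      Cnorm (Cpow t r * F t - csum (fun j => d j * Cpow t j) (S N))%CC < eps).
  { intros t Ht Htr eps Heps. pose proof (Cnorm_gt_0 t Ht) as Hn.
    assert (HP : 0 < Cnorm t ^ r) by (now apply pow_lt).
    destruct (H t (conj Hn Htr) (eps / Cnorm t ^ r)) as [N0 HN0].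
    { now apply Rdiv_lt_0_compat. }
    exists N0. intros N HN. specialize (HN0 N HN). rewrite laurent_partial_csum in HN0 by assumption.
    change (fun j => (c (Z.of_nat j - Z.of_nat r)%Z * Cpow t j)%CC)
      with (fun j => (d j * Cpow t j)%CC) in HN0.
    set (S1 := csum _ _) in *.
    replace (Cpow t r * F t - S1)%CC with (- (Cpow t r * (/ Cpow t r * S1 - F t)))%CC.
    2: { transitivity (Cpow t r * F t - (Cpow t r * / Cpow t r) * S1)%CC; [ring|].
         rewrite Cinv_r by (now apply Cpow_neq_0). ring. }
    rewrite Cnorm_opp, Cnorm_mul, Cnorm_pow.
    replace eps with (Cnorm t ^ r * (eps / Cnorm t ^ r)) by (field; lra).
    now apply Rmult_lt_compat_l. }
  set (s := rho / 2). assert (Hs : 0 < s) by (unfold s; lra).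
  assert (Hns : Cnorm (RtoC s) = s) by (rewrite Cnorm_RtoC; apply Rabs_pos_eq; lra).
  assert (Hs0 : RtoC s <> C0) by (apply RtoC_neq_0; lra).
  assert (HA : exists A, 0 <= A /\ forall n, Cnorm (d n) * s ^ n <= A).
  { destruct (Hlim (RtoC s) Hs0 ltac:(rewrite Hns; unfold s; lra) 1 ltac:(lra)) as [N0 HN0].
    (* A single term is the difference of two consecutive errors, each below 1. *)
    apply (bounded_eventually _ 2 (S N0)). intros n Hn.
    destruct n as [|n]; [lia|].
    pose proof (HN0 n ltac:(lia)) as B1. pose proof (HN0 (S n) ltac:(lia)) as B2.
    rewrite <- Hns at 1. rewrite <- Cnorm_pow, <- Cnorm_mul.
    set (f := fun j => (d j * Cpow (RtoC s) j)%CC) in *.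
    change (Cnorm (f (S n)) <= 2).
    replace (f (S n)) with ((Cpow (RtoC s) r * F (RtoC s) - csum f (S n))
      - (Cpow (RtoC s) r * F (RtoC s) - csum f (S (S n))))%CC by (simpl; ring).
    eapply Rle_trans; [apply Cnorm_sub|]. lra. }
  destruct HA as (A & HA0 & HA).
  exists (2 * A), (/ s). split; [lra|]. split; [now apply Rinv_0_lt_compat|].
  intros N t Ht Htq. pose proof (Cnorm_gt_0 t Ht) as Hn.
  assert (Htr : Cnorm t < rho).
  { apply Rmult_le_compat_l with (r := s) in Htq; [|lra].
    rewrite <- Rmult_assoc, Rinv_r in Htq by lra. unfold s in Htq. lra. }
  set (x := / s * Cnorm t) in *.
  assert (Hx0 : 0 <= x) by (apply Rmult_le_pos; [apply Rlt_le, Rinv_0_lt_compat|]; lra).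
  (* The remainder of order [N] is compared with a partial sum far enough out to be within [eps] of
     the function; the block in between is geometric. *)
  apply le_epsilon. intros eps Heps.
  destruct (Hlim t Ht Htr eps Heps) as [N0 HN0].
  specialize (HN0 (N + N0)%nat ltac:(lia)).
  set (f := fun j => (d j * Cpow t j)%CC) in *.
  assert (B : Cnorm (csum f (N + S N0) - csum f N)%CC <= 2 * A * x ^ N).
  { apply geometric_csum_bound; [split; lra | assumption|].
    intros i. unfold f, x. rewrite Cnorm_mul, Cnorm_pow, Rpow_mult_distr, <- Rmult_assoc.
    apply Rmult_le_compat_r; [apply pow_le; lra|].
    assert (Hp : 0 < s ^ i) by (now apply pow_lt).
    apply Rmult_le_reg_r with (s ^ i); [assumption|].
    rewrite pow_inv, Rmult_assoc, Rinv_l, Rmult_1_r by lra. apply HA. }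
  replace (S (N + N0)) with (N + S N0)%nat in HN0 by lia.
  replace (Cpow t r * F t - csum f N)%CC
    with ((Cpow t r * F t - csum f (N + S N0)) + (csum f (N + S N0) - csum f N))%CC by ring.
  eapply Rle_trans; [apply Cnorm_add|]. lra.
Qed.

Lemma Re_pos_neq_0 (o : CC) : 0 < Re o -> o <> C0.
Proof. intros H E. rewrite E in H. unfold Re, C0 in H; simpl in H. lra. Qed.

(** It suffices to exhibit one Laurent expansion, because [epsilon] then returns a sequence with the
    same property; one is built from the expansions of the factors. *)
Lemma abern_laurent (om : list CC) (w : CC) : (forall o, In o om -> o <> C0) ->
  laurent_expansion (fun t => f_omega om t * Cexp (- (w * t)))%CC (length om)
    (fun n => abern n w om).
Proof.
  intros Hom. unfold abern. apply epsilon_spec.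
  destruct (expandable_f_omega om Hom) as [c Hc].
  eexists. apply laurent_of_expandable.
  eapply expandable_ext; [| |exact (expandable_mul _ _ _ _ Hc (expandable_exp (- w)%CC))];
    [|reflexivity].
  intros t _. cbv beta. replace (- w * t)%CC with (- (w * t))%CC by ring. ring.
Qed.

Lemma abern_expandable (om : list CC) (w : CC) : (forall o, In o om -> o <> C0) ->
  expandable (fun t => Cpow t (length om) * (f_omega om t * Cexp (- (w * t))))%CC
    (fun n => abern (Z.of_nat n - Z.of_nat (length om)) w om).
Proof. intros Hom. exact (expandable_of_laurent _ _ _ (abern_laurent om w Hom)). Qed.

(** The generating function of the left side is the product of those for [(al, a)] and [(om, w)].
    After multiplication by [t^(r+l)] both sides are the coefficient of index [K = k + r + l], so
    uniqueness applies. *)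
Lemma abern_app (om al : list CC) (w a : CC) (k : Z) :
  (forall o, In o om -> o <> C0) -> (forall o, In o al -> o <> C0) ->
  (- Z.of_nat (length om + length al) <= k)%Z ->
  abern k (w + a)%CC (om ++ al)
  = sumZ (- Z.of_nat (length al)) (Z.of_nat (length om) + k)
      (fun N => Cmul (abern N a al) (abern (k - N) w om)).
Proof.
  intros Hom Hal Hk.
  set (K := Z.to_nat (k + Z.of_nat (length om + length al))).
  pose proof (abern_expandable (om ++ al) (w + a)%CC
    ltac:(intros o Ho; apply in_app_or in Ho; destruct Ho; auto)) as H.
  pose proof (expandable_mul _ _ _ _ (abern_expandable al a Hal) (abern_expandable om w Hom)) as H2.
  cbv beta in H2.
  eapply (expandable_ext _ (fun t => Cpow t (length (om ++ al)) *
      (f_omega (om ++ al) t * Cexp (- ((w + a) * t))))%CC) in H2; [| |reflexivity].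
  2: { intros t _. rewrite length_app, Cpow_add, f_omega_app.
       replace (- ((w + a) * t))%CC with (- (w * t) + - (a * t))%CC by ring.
       rewrite Cexp_add. ring. }
  pose proof (expandable_unique _ _ _ K H H2) as E. cbv beta in E.
  rewrite length_app in E.
  replace (Z.of_nat K - Z.of_nat (length om + length al))%Z with k in E by lia.
  rewrite E, sumZ_csum. unfold conv.
  replace (Z.to_nat (Z.of_nat (length om) + k - - Z.of_nat (length al) + 1)) with (S K) by lia.
  apply csum_ext. intros i Hi. f_equal; f_equal; lia.
Qed.

(** * Holomorphic functions and complex integrals *)

Ltac eq_in_R := match goal with |- ?a = ?b => change (@eq R a b) end.

Lemma is_derive_div_norm2 (u v n : R -> R) x du dv dn : u x ^ 2 + v x ^ 2 <> 0 ->
  is_derive u x du -> is_derive v x dv -> is_derive n x dn ->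
  is_derive (fun s => n s / (u s ^ 2 + v s ^ 2)) x
    ((dn * (u x ^ 2 + v x ^ 2) - n x * (2 * u x * du + 2 * v x * dv)) / (u x ^ 2 + v x ^ 2) ^ 2).
Proof.
  intros H0 Hu Hv Hn.
  assert (Hq : is_derive (fun s => u s ^ 2 + v s ^ 2) x (2 * u x * du + 2 * v x * dv)).
  { apply (is_derive_ext (fun s => u s * u s + v s * v s)); [intros; eq_in_R; ring|].
    replace (2 * u x * du + 2 * v x * dv)
      with ((du * u x + u x * du) + (dv * v x + v x * dv)) by ring.
    apply (@is_derive_plus R_AbsRing R_NormedModule (fun s => u s * u s) (fun s => v s * v s));
    now apply is_derive_Rmult. }
  evar_last; [exact (is_derive_div n _ x _ _ Hn Hq H0)|]. reflexivity.
Qed.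

Lemma cder_inv h x d : h x <> C0 -> cder h x d ->
  cder (fun s => / h s)%CC x (- (/ h x * / h x * d))%CC.
Proof.
  intros H0 [H1 H2].
  assert (Hn : fst (h x) ^ 2 + snd (h x) ^ 2 <> 0).
  { intros E. apply H0. apply CC_eq; simpl; nra. }
  split.
  - evar_last; [exact (is_derive_div_norm2 _ _ _ x _ _ _ Hn H1 H2 H1)|]. simpl.
    eq_in_R. field. intros E; apply Hn; rewrite <- E; ring.
  - evar_last; [exact (is_derive_div_norm2 _ _ _ x _ _ _ Hn H1 H2
      (@is_derive_opp R_AbsRing R_NormedModule _ x _ H2))|].
    simpl. eq_in_R.
    unfold opp; simpl. field. intros E; apply Hn; rewrite <- E; ring.
Qed.

(** The parameter space is arbitrary because continuity is needed in one real variable and also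
    jointly in radius and angle. *)
Definition ccont {T : UniformSpace} (h : T -> CC) (p : T) : Prop :=
  continuous (fun s => fst (h s)) p /\ continuous (fun s => snd (h s)) p.

Lemma ccont_const {T : UniformSpace} (z : CC) (p : T) : ccont (fun _ => z) p.
Proof. split; apply continuous_const. Qed.

Lemma ccont_add {T : UniformSpace} (h g : T -> CC) p :
  ccont h p -> ccont g p -> ccont (fun s => h s + g s)%CC p.
Proof.
  intros [H1 H2] [G1 G2]; split; simpl;
  apply (@continuous_plus T R_AbsRing R_NormedModule); assumption.
Qed.

Lemma ccont_mul {T : UniformSpace} (h g : T -> CC) p :
  ccont h p -> ccont g p -> ccont (fun s => h s * g s)%CC p.
Proof.
  intros [H1 H2] [G1 G2]; split; simpl.
  - apply (@continuous_minus T R_AbsRing R_NormedModule (fun s => fst (h s) * fst (g s))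
      (fun s => snd (h s) * snd (g s)));
    apply (@continuous_mult T R_AbsRing); assumption.
  - apply (@continuous_plus T R_AbsRing R_NormedModule (fun s => fst (h s) * snd (g s))
      (fun s => snd (h s) * fst (g s)));
    apply (@continuous_mult T R_AbsRing); assumption.
Qed.

Lemma ccont_exp {T : UniformSpace} (h : T -> CC) p : ccont h p -> ccont (fun s => Cexp (h s)) p.
Proof.
  intros [H1 H2].
  pose proof (continuous_comp (fun s => fst (h s)) exp p H1 (continuous_exp _)) as He.
  pose proof (continuous_comp (fun s => snd (h s)) cos p H2 (continuous_cos _)) as Hc.
  pose proof (continuous_comp (fun s => snd (h s)) sin p H2 (continuous_sin _)) as Hs.
  split; simpl.
  - exact (@continuous_mult T R_AbsRing _ _ p He Hc).
  - exact (@continuous_mult T R_AbsRing _ _ p He Hs).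
Qed.

Lemma ccont_inv {T : UniformSpace} (h : T -> CC) p :
  h p <> C0 -> ccont h p -> ccont (fun s => / h s)%CC p.
Proof.
  intros H0 [H1 H2].
  assert (Hn : fst (h p) ^ 2 + snd (h p) ^ 2 <> 0).
  { intros E. apply H0. apply CC_eq; simpl; nra. }
  assert (C2 : forall f : T -> R, continuous f p -> continuous (fun s => f s ^ 2) p).
  { intros f Hf. apply continuous_ext with (fun s => f s * f s); [intros; eq_in_R; ring|].
    now apply (@continuous_mult T R_AbsRing). }
  assert (Hd : continuous (fun s => / (fst (h s) ^ 2 + snd (h s) ^ 2)) p).
  { apply (continuous_comp (fun s => fst (h s) ^ 2 + snd (h s) ^ 2) Rinv).
    - apply (@continuous_plus T R_AbsRing R_NormedModule); apply C2; assumption.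
    - now apply continuous_Rinv. }
  split; simpl.
  - now apply (@continuous_mult T R_AbsRing).
  - apply (@continuous_mult T R_AbsRing); [|assumption].
    now apply (@continuous_opp T R_AbsRing R_NormedModule).
Qed.

Lemma ccont_cder (h : R -> CC) x d : cder h x d -> ccont h x.
Proof.
  intros [H1 H2]; split; apply (@ex_derive_continuous R_AbsRing R_NormedModule); eexists; eassumption.
Qed.

Definition cont_at (G : CC -> CC) (t : CC) : Prop :=
  forall (T : UniformSpace) (h : T -> CC) p, h p = t -> ccont h p -> ccont (fun s => G (h s)) p.

(** Holomorphy with a continuous derivative, tested along curves and along continuous
    parametrizations, so that only real one-variable derivatives are needed. *)
Definition holo_on (U : CC -> Prop) (G : CC -> CC) : Prop :=
  exists G', forall t, U t -> cont_at G t /\ cont_at G' t /\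
    forall h s d, h s = t -> cder h s d -> cder (fun u => G (h u)) s (G' t * d)%CC.

Lemma cder_eq h x d e : d = e -> cder h x d -> cder h x e.
Proof. intros ->; trivial. Qed.

Lemma holo_const U z : holo_on U (fun _ => z).
Proof.
  exists (fun _ => C0). intros t _. split; [|split].
  - intros T h p _ _. apply ccont_const.
  - intros T h p _ _. apply ccont_const.
  - intros h s d _ _. eapply cder_eq; [|apply cder_const]. ring.
Qed.

Lemma holo_id U : holo_on U (fun t => t).
Proof.
  exists (fun _ => C1). intros t _. split; [|split].
  - intros T h p _ H. exact H.
  - intros T h p _ H. apply ccont_const.
  - intros h s d _ H. eapply cder_eq; [|exact H]. ring.
Qed.

Lemma holo_add U F G : holo_on U F -> holo_on U G -> holo_on U (fun t => F t + G t)%CC.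
Proof.
  intros [F' HF] [G' HG]. exists (fun t => F' t + G' t)%CC. intros t Ht.
  destruct (HF t Ht) as (F1 & F2 & F3), (HG t Ht) as (G1 & G2 & G3). split; [|split].
  - intros T h p E H. apply ccont_add; [now apply F1 | now apply G1].
  - intros T h p E H. apply ccont_add; [now apply F2 | now apply G2].
  - intros h s d E H. eapply cder_eq; [|apply (cder_add (fun u => F (h u)) (fun u => G (h u))); [exact (F3 h s d E H) | exact (G3 h s d E H)]]. ring.
Qed.

Lemma holo_mul U F G : holo_on U F -> holo_on U G -> holo_on U (fun t => F t * G t)%CC.
Proof.
  intros [F' HF] [G' HG]. exists (fun t => F' t * G t + F t * G' t)%CC. intros t Ht.
  destruct (HF t Ht) as (F1 & F2 & F3), (HG t Ht) as (G1 & G2 & G3). split; [|split].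
  - intros T h p E H. apply ccont_mul; [now apply F1 | now apply G1].
  - intros T h p E H. apply ccont_add; apply ccont_mul; unfold cont_at in *; auto.
  - intros h s d E H. eapply cder_eq; [|apply (cder_mul (fun u => F (h u)) (fun u => G (h u))); [exact (F3 h s d E H) | exact (G3 h s d E H)]].
    rewrite E. ring.
Qed.

Lemma holo_inv U F : (forall t, U t -> F t <> C0) -> holo_on U F -> holo_on U (fun t => / F t)%CC.
Proof.
  intros H0 [F' HF]. exists (fun t => - C1 * (/ F t * / F t * F' t))%CC. intros t Ht.
  destruct (HF t Ht) as (F1 & F2 & F3). specialize (H0 t Ht). split; [|split].
  - intros T h p E H. apply ccont_inv; [now rewrite E | now apply F1].
  - intros T h p E H. apply ccont_mul; [apply ccont_const|].
    apply ccont_mul; [apply ccont_mul|]; auto; (apply ccont_inv; [now rewrite E | now apply F1]).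
  - intros h s d E H. eapply cder_eq; [|apply (cder_inv (fun u => F (h u))); [now rewrite E | exact (F3 h s d E H)]].
    rewrite E. ring.
Qed.

Lemma holo_exp U F : holo_on U F -> holo_on U (fun t => Cexp (F t)).
Proof.
  intros [F' HF]. exists (fun t => Cexp (F t) * F' t)%CC. intros t Ht.
  destruct (HF t Ht) as (F1 & F2 & F3). split; [|split].
  - intros T h p E H. apply ccont_exp. now apply F1.
  - intros T h p E H. apply ccont_mul; [apply ccont_exp|]; auto.
  - intros h s d E H. eapply cder_eq; [|apply (cder_exp (fun u => F (h u))); exact (F3 h s d E H)].
    rewrite E. ring.
Qed.

Lemma holo_weaken (U V : CC -> Prop) G : (forall t, V t -> U t) -> holo_on U G -> holo_on V G.
Proof. intros H [G' HG]. exists G'. auto. Qed.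

Lemma holo_pow U n : holo_on U (fun t => Cpow t n).
Proof.
  induction n as [|n IH]; [exact (holo_const U C1)|].
  exact (holo_mul U _ _ (holo_id U) IH).
Qed.

Lemma holo_powz (U : CC -> Prop) k : (forall t, U t -> t <> C0) -> holo_on U (fun t => Cpowz t k).
Proof.
  intros H. unfold Cpowz. destruct (Z.leb 0 k); [apply holo_pow|].
  apply holo_inv; [|apply holo_pow]. intros t Ht; apply Cpow_neq_0; auto.
Qed.

(** * Integrals over segments and half-lines *)

Lemma CRInt_iff h a b v : CRInt h a b v <->
  is_RInt (fun x => fst (h x)) a b (fst v) /\ is_RInt (fun x => snd (h x)) a b (snd v).
Proof.
  assert (K : forall (f : R -> R) l, (exists pr : Riemann_integrable f a b, RiemannInt pr = l)
     <-> is_RInt f a b l).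
  { intros f l; split.
    - intros [pr E]. rewrite <- E, <- RInt_Reals. apply (@RInt_correct R_CompleteNormedModule).
      now apply ex_RInt_Reals_1.
    - intros H. exists (ex_RInt_Reals_0 _ _ _ (ex_intro _ _ H)). rewrite <- RInt_Reals.
      now apply (@is_RInt_unique R_CompleteNormedModule). }
  unfold CRInt. now rewrite !K.
Qed.

Lemma CRInt_unique h a b u v : CRInt h a b u -> CRInt h a b v -> u = v.
Proof.
  rewrite !CRInt_iff. intros [H1 H2] [G1 G2].
  apply (@is_RInt_unique R_CompleteNormedModule) in H1, H2, G1, G2. apply CC_eq; congruence.
Qed.

Lemma CRInt_ext h g a b v : (forall x, a <= x <= b -> h x = g x) -> a <= b ->
  CRInt h a b v -> CRInt g a b v.
Proof.
  rewrite !CRInt_iff. intros E Hab [H1 H2]; split;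
  (eapply is_RInt_ext; [|eassumption]); rewrite Rmin_left, Rmax_right by lra;
  intros x Hx; now rewrite E by lra.
Qed.

Lemma CRInt_add h g a b u v : CRInt h a b u -> CRInt g a b v ->
  CRInt (fun x => h x + g x)%CC a b (u + v)%CC.
Proof.
  rewrite !CRInt_iff. intros [H1 H2] [G1 G2]; split;
  now apply (@is_RInt_plus R_NormedModule).
Qed.

Lemma CRInt_scale z h a b u : CRInt h a b u -> CRInt (fun x => z * h x)%CC a b (z * u)%CC.
Proof.
  rewrite !CRInt_iff. intros [H1 H2].
  assert (K : forall c f l, is_RInt f a b l -> is_RInt (fun x => c * f x) a b (c * l))
    by (intros; now apply (@is_RInt_scal R_NormedModule)).
  split; simpl.
  - apply (@is_RInt_minus R_NormedModule (fun x => fst z * fst (h x)) (fun x => snd z * snd (h x)));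
    now apply K.
  - apply (@is_RInt_plus R_NormedModule (fun x => fst z * snd (h x)) (fun x => snd z * fst (h x)));
    now apply K.
Qed.

Lemma CRInt_Chasles h a b c u v : CRInt h a b u -> CRInt h b c v -> CRInt h a c (u + v)%CC.
Proof.
  rewrite !CRInt_iff. intros [H1 H2] [G1 G2]; split;
  eapply (@is_RInt_Chasles R_NormedModule); eassumption.
Qed.

Lemma CRInt_continuous h a b : a <= b -> (forall x, a <= x <= b -> ccont h x) ->
  exists v, CRInt h a b v.
Proof.
  intros Hab H.
  destruct (@ex_RInt_continuous R_CompleteNormedModule (fun x => fst (h x)) a b) as [u Hu].
  { rewrite Rmin_left, Rmax_right by lra. intros x Hx; now apply H. }
  destruct (@ex_RInt_continuous R_CompleteNormedModule (fun x => snd (h x)) a b) as [v Hv].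
  { rewrite Rmin_left, Rmax_right by lra. intros x Hx; now apply H. }
  exists (u, v). rewrite CRInt_iff. now split.
Qed.

(** The factor [2] is lost by integrating the two components separately. *)
Lemma CRInt_norm_le h g a b v l : a <= b -> (forall x, a <= x <= b -> Cnorm (h x) <= g x) ->
  CRInt h a b v -> is_RInt g a b l -> Cnorm v <= 2 * l.
Proof.
  rewrite CRInt_iff. intros Hab H [H1 H2] Hg.
  eapply Rle_trans; [apply Cnorm_le_sum|].
  assert (Rabs (fst v) <= l).
  { apply (@norm_RInt_le R_NormedModule (fun x => fst (h x)) g a b (fst v) l Hab); try assumption.
    intros x Hx. eapply Rle_trans; [apply (Cnorm_fst (h x)) | now apply H]. }
  assert (Rabs (snd v) <= l).
  { apply (@norm_RInt_le R_NormedModule (fun x => snd (h x)) g a b (snd v) l Hab); try assumption.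
    intros x Hx. eapply Rle_trans; [apply (Cnorm_snd (h x)) | now apply H]. }
  lra.
Qed.

Lemma is_RInt_exp_decay (B s a b : R) : 0 < s ->
  is_RInt (fun x => B * exp (- s * x)) a b (B / s * (exp (- s * a) - exp (- s * b))).
Proof.
  intros Hs.
  replace (B / s * (exp (- s * a) - exp (- s * b)))
    with (minus (- (B / s) * exp (- s * b)) (- (B / s) * exp (- s * a)))
    by (unfold minus, plus, opp; simpl; ring).
  apply (@is_RInt_derive R_CompleteNormedModule (fun x => - (B / s) * exp (- s * x))).
  - intros x _. auto_derive; [trivial|]. field. lra.
  - intros x _. apply (@ex_derive_continuous R_AbsRing R_NormedModule). auto_derive. trivial.
Qed.

Lemma CRInt_decay_le h (B s a b : R) v : 0 < s -> 0 <= B -> a <= b ->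
  (forall x, a <= x <= b -> Cnorm (h x) <= B * exp (- s * x)) ->
  CRInt h a b v -> Cnorm v <= 2 * (B / s) * exp (- s * a).
Proof.
  intros Hs HB Hab H Hv.
  pose proof (CRInt_norm_le h _ a b v _ Hab H Hv (is_RInt_exp_decay B s a b Hs)) as K.
  pose proof (exp_pos (- s * b)).
  assert (0 <= B / s) by (apply Rmult_le_pos; [lra | apply Rlt_le, Rinv_0_lt_compat; lra]). nra.
Qed.

(** Exponential decay makes the truncated integrals a Cauchy family; the limit is taken in each
    coordinate by completeness of the reals. *)
Lemma CImpInt_intro h (B s a : R) : 0 < s -> 0 <= B ->
  (forall x, a <= x -> ccont h x) ->
  (forall x, a <= x -> Cnorm (h x) <= B * exp (- s * x)) -> exists v, CImpInt h a v.
Proof.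
  intros Hs HB Hc Hb.
  assert (Hex : forall b c, a <= b -> b <= c -> exists v, CRInt h b c v).
  { intros b c Hab Hbc. apply CRInt_continuous; [assumption|]. intros; apply Hc; lra. }
  set (F := fun b => cint h a b).
  assert (HF : forall b, a <= b -> CRInt h a b (F b)).
  { intros b Hab. unfold F, cint. apply epsilon_spec. apply Hex; lra. }
  assert (HFF : forall b c, a <= b -> b <= c -> Cnorm (F c - F b)%CC <= 2 * (B / s) * exp (- s * b)).
  { intros b c Hab Hbc. destruct (Hex b c Hab Hbc) as [v Hv].
    rewrite (CRInt_unique h a c (F c) (F b + v)%CC (HF c ltac:(lra))
      (CRInt_Chasles _ _ _ _ _ _ (HF b Hab) Hv)).
    replace (F b + v - F b)%CC with v by ring.
    eapply CRInt_decay_le; try eassumption. intros; apply Hb; lra. }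
  assert (Hsmall : forall eps, 0 < eps -> exists M, a <= M /\ forall b c, M <= b -> M <= c ->
    Cnorm (F c - F b)%CC < eps).
  { intros eps Heps. set (A := 2 * (B / s)).
    assert (HA : 0 <= A) by (unfold A; apply Rmult_le_pos; [lra | apply Rmult_le_pos; [lra |
      apply Rlt_le, Rinv_0_lt_compat; lra]]).
    (* Beyond this point [exp (-s b) <= eps / (2 (A + 1))], so the tail [A exp (-s b)] is at most
       [eps/2]. *)
    exists (Rmax a (- ln (eps / (2 * (A + 1))) / s)). split; [apply Rmax_l|].
    assert (K : forall b c, Rmax a (- ln (eps / (2 * (A + 1))) / s) <= b -> b <= c ->
      Cnorm (F c - F b)%CC < eps).
    { intros b c H1 H2. eapply Rle_lt_trans.
      { apply HFF; [|assumption]. eapply Rle_trans; [apply Rmax_l | eassumption]. }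
      fold A. assert (He : 0 < eps / (2 * (A + 1))) by (apply Rdiv_lt_0_compat; lra).
      assert (E : exp (- s * b) <= eps / (2 * (A + 1))).
      { rewrite <- (exp_ln (eps / (2 * (A + 1)))) by assumption. apply exp_le.
        assert (H3 : - ln (eps / (2 * (A + 1))) / s <= b)
          by (eapply Rle_trans; [apply Rmax_r | eassumption]).
        apply Rmult_le_compat_l with (r := s) in H3; [|lra].
        replace (s * (- ln (eps / (2 * (A + 1))) / s)) with (- ln (eps / (2 * (A + 1)))) in H3 by (field; lra).
        lra. }
      apply Rle_lt_trans with ((A + 1) * (eps / (2 * (A + 1)))).
      - pose proof (exp_pos (- s * b)). nra.
      - replace ((A + 1) * (eps / (2 * (A + 1)))) with (eps / 2) by (field; lra). lra. }
    intros b c Hb' Hc'. destruct (Rle_dec b c) as [H|H]; [now apply K|].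
    rewrite Cnorm_sub_sym. apply K; lra. }
  assert (Hlim : forall p : CC -> R, (forall z u, Rabs (p z - p u) <= Cnorm (z - u)%CC) ->
    exists l, filterlim (fun b => p (F b)) (Rbar_locally p_infty) (locally l)).
  { intros p Hp. apply (@filterlim_locally_cauchy R R_CompleteSpace (Rbar_locally p_infty) _).
    intros eps. destruct (Hsmall eps (cond_pos eps)) as (M & HM & K).
    exists (fun b => M < b). split; [now exists M|]. intros b c H1 H2.
    unfold ball; simpl; unfold AbsRing_ball, abs, minus, plus, opp; simpl.
    eapply Rle_lt_trans; [apply Hp | apply K; lra]. }
  destruct (Hlim fst) as [l1 L1].
  { intros z u. apply (Cnorm_fst (z - u)%CC). }
  destruct (Hlim snd) as [l2 L2].
  { intros z u. apply (Cnorm_snd (z - u)%CC). }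
  exists (l1, l2). split.
  { intros b Hab. exists (F b). now apply HF. }
  intros eps Heps.
  destruct (proj1 (filterlim_locally _ _) L1 (mkposreal (eps / 2) ltac:(lra))) as [M1 K1].
  destruct (proj1 (filterlim_locally _ _) L2 (mkposreal (eps / 2) ltac:(lra))) as [M2 K2].
  exists (Rmax M1 M2 + 1). intros b vb HM Hab Hvb.
  rewrite (CRInt_unique _ _ _ _ _ Hvb (HF b Hab)).
  pose proof (Rmax_l M1 M2). pose proof (Rmax_r M1 M2).
  specialize (K1 b ltac:(lra)). specialize (K2 b ltac:(lra)).
  unfold ball in K1, K2; simpl in K1, K2; unfold AbsRing_ball, abs, minus, plus, opp in K1, K2; simpl in K1, K2.
  eapply Rle_lt_trans; [apply Cnorm_le_sum|]. unfold Csub; simpl. lra.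
Qed.

(** The existence clause of [CImpInt] keeps its limit clause from being vacuous: it supplies a
    truncated integral that is close to both values. *)
Lemma CImpInt_unique h a u v : CImpInt h a u -> CImpInt h a v -> u = v.
Proof.
  intros [Hex Hu] [_ Hv].
  assert (E : (u - v)%CC = C0).
  { apply Cnorm_eq_0, Rle_antisym; [|apply Cnorm_ge_0]. apply le_epsilon. intros eps Heps.
    destruct (Hu (eps / 2) ltac:(lra)) as [M1 K1]. destruct (Hv (eps / 2) ltac:(lra)) as [M2 K2].
    set (b := Rmax a (Rmax M1 M2)).
    assert (a <= b) by apply Rmax_l.
    assert (Rmax M1 M2 <= b) by apply Rmax_r.
    pose proof (Rmax_l M1 M2). pose proof (Rmax_r M1 M2).
    destruct (Hex b ltac:(assumption)) as [vb Hvb].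
    specialize (K1 b vb ltac:(lra) ltac:(lra) Hvb). specialize (K2 b vb ltac:(lra) ltac:(lra) Hvb).
    replace (u - v)%CC with ((vb - v) - (vb - u))%CC by ring.
    eapply Rle_trans; [apply Cnorm_sub|]. lra. }
  transitivity ((u - v) + v)%CC; [ring|]. rewrite E. ring.
Qed.

Lemma CImpInt_add h g a u v : CImpInt h a u -> CImpInt g a v ->
  CImpInt (fun x => h x + g x)%CC a (u + v)%CC.
Proof.
  intros [Hex Hu] [Gex Hv]. split.
  { intros b Hb. destruct (Hex b Hb) as [x Hx], (Gex b Hb) as [y Hy].
    exists (x + y)%CC. now apply CRInt_add. }
  intros eps Heps.
  destruct (Hu (eps / 2) ltac:(lra)) as [M1 K1]. destruct (Hv (eps / 2) ltac:(lra)) as [M2 K2].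
  exists (Rmax M1 M2). intros b vb HM Hb Hvb.
  pose proof (Rmax_l M1 M2). pose proof (Rmax_r M1 M2).
  destruct (Hex b Hb) as [x Hx], (Gex b Hb) as [y Hy].
  rewrite (CRInt_unique _ _ _ _ _ Hvb (CRInt_add _ _ _ _ _ _ Hx Hy)).
  specialize (K1 b x ltac:(lra) Hb Hx). specialize (K2 b y ltac:(lra) Hb Hy).
  replace (x + y - (u + v))%CC with ((x - u) + (y - v))%CC by ring.
  eapply Rle_lt_trans; [apply Cnorm_add|]. lra.
Qed.

Lemma CImpInt_scale z h a u : CImpInt h a u -> CImpInt (fun x => z * h x)%CC a (z * u)%CC.
Proof.
  intros [Hex Hu]. split.
  { intros b Hb. destruct (Hex b Hb) as [x Hx]. exists (z * x)%CC. now apply CRInt_scale. }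
  intros eps Heps. pose proof (Cnorm_ge_0 z).
  destruct (Hu (eps / (Cnorm z + 1)) ltac:(apply Rdiv_lt_0_compat; lra)) as [M K].
  exists M. intros b vb HM Hb Hvb. destruct (Hex b Hb) as [x Hx].
  rewrite (CRInt_unique _ _ _ _ _ Hvb (CRInt_scale z _ _ _ _ Hx)).
  specialize (K b x HM Hb Hx).
  replace (z * x - z * u)%CC with (z * (x - u))%CC by ring. rewrite Cnorm_mul.
  replace eps with ((Cnorm z + 1) * (eps / (Cnorm z + 1))) by (field; lra).
  pose proof (Cnorm_ge_0 (x - u)%CC). nra.
Qed.

Lemma CImpInt_ext h g a v : (forall x, a <= x -> h x = g x) -> CImpInt h a v -> CImpInt g a v.
Proof.
  intros E [Hex H]. split.
  { intros b Hb. destruct (Hex b Hb) as [u Hu]. exists u.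
    eapply CRInt_ext; [|exact Hb|exact Hu]. intros; apply E; lra. }
  intros eps Heps. destruct (H eps Heps) as [M K]. exists M. intros b vb HM Hb Hvb.
  apply (K b vb HM Hb). eapply CRInt_ext; [|exact Hb|exact Hvb]. intros; symmetry; apply E; lra.
Qed.

Lemma CImpInt_Chasles h a b u v : a <= b -> CRInt h a b u -> CImpInt h b v ->
  CImpInt h a (u + v)%CC.
Proof.
  intros Hab Hu [Hex H].
  assert (Hsplit : forall c, a <= c -> exists w, CRInt h a c w).
  { intros c Hac. destruct (Rle_dec b c) as [Hbc|Hbc].
    - destruct (Hex c Hbc) as [w Hw]. exists (u + w)%CC. eapply CRInt_Chasles; eassumption.
    - apply CRInt_iff in Hu. destruct Hu as [H1 H2].
      destruct (@ex_RInt_Chasles_1 R_CompleteNormedModule (fun x => fst (h x)) a c b ltac:(lra)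
        (ex_intro _ _ H1)) as [x Hx].
      destruct (@ex_RInt_Chasles_1 R_CompleteNormedModule (fun x => snd (h x)) a c b ltac:(lra)
        (ex_intro _ _ H2)) as [y Hy].
      exists (x, y). apply CRInt_iff. now split. }
  split; [exact Hsplit|].
  intros eps Heps. destruct (H eps Heps) as [M K]. exists (Rmax b M). intros c vc HM Hac Hvc.
  pose proof (Rmax_l b M). pose proof (Rmax_r b M).
  destruct (Hex c ltac:(lra)) as [w Hw].
  rewrite (CRInt_unique _ _ _ _ _ Hvc (CRInt_Chasles _ _ _ _ _ _ Hu Hw)).
  replace (u + w - (u + v))%CC with (w - v)%CC by ring. apply (K c w); [lra | lra | assumption].
Qed.

(** Here a decay rate [s] turns into the bound [1/s] of the final estimate. The bound is the same
    for every [a >= 0], so it survives the shrinking of the radius. *)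
Lemma CImpInt_decay_le h (B s a : R) v : 0 < s -> 0 <= B -> 0 <= a ->
  (forall x, a <= x -> Cnorm (h x) <= B * exp (- s * x)) ->
  CImpInt h a v -> Cnorm v <= 2 * (B / s).
Proof.
  intros Hs HB Ha Hb [Hex H]. apply le_epsilon. intros eps Heps.
  destruct (H eps Heps) as [M K].
  pose proof (Rmax_l a M). pose proof (Rmax_r a M).
  destruct (Hex (Rmax a M) ltac:(assumption)) as [u Hu].
  specialize (K (Rmax a M) u ltac:(assumption) ltac:(assumption) Hu).
  assert (Hn : Cnorm u <= 2 * (B / s) * exp (- s * a)).
  { eapply CRInt_decay_le; try eassumption. intros; apply Hb; lra. }
  assert (exp (- s * a) <= 1) by (rewrite <- exp_0; apply exp_le; nra).
  assert (0 <= B / s) by (apply Rmult_le_pos; [lra | apply Rlt_le, Rinv_0_lt_compat; lra]).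
  rewrite Cnorm_sub_sym in K.
  replace v with ((v - u) + u)%CC by ring. eapply Rle_trans; [apply Cnorm_add|]. nra.
Qed.

(** * The contour integral and its radius *)

Definition circle_integrand (G : CC -> CC) (lam th : R) : CC :=
  let t := (RtoC lam * Cexp (0%R, th))%CC in ((G t * (ln lam, th)) * (Ci * t))%CC.

Lemma Cnorm_polar (lam th : R) : 0 < lam -> Cnorm (RtoC lam * Cexp (0%R, th))%CC = lam.
Proof.
  intros H. rewrite Cnorm_mul, Cnorm_RtoC, Cnorm_exp, Rabs_pos_eq by lra. simpl.
  rewrite exp_0. ring.
Qed.

Lemma Cexp_i_derivative (th : R) : cder (fun y => Cexp (0%R, y)) th (Ci * Cexp (0%R, th))%CC.
Proof.
  eapply cder_eq; [|apply (cder_exp (fun y => (0%R, y)) th Ci)]; [ring|].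
  split; simpl; [apply (@is_derive_const R_AbsRing R_NormedModule) | apply (@is_derive_id R_AbsRing)].
Qed.

Lemma circle_integrand_continuous (U : CC -> Prop) G lam th : holo_on U G ->
  U (RtoC lam * Cexp (0%R, th))%CC -> ccont (circle_integrand G lam) th.
Proof.
  intros [G' HG] HU. destruct (HG _ HU) as (G1 & _ & _).
  assert (Ht : ccont (fun y => RtoC lam * Cexp (0%R, y))%CC th).
  { apply ccont_mul; [apply ccont_const|]. eapply ccont_cder, Cexp_i_derivative. }
  unfold circle_integrand. apply ccont_mul; apply ccont_mul.
  - now apply (G1 _ (fun y => RtoC lam * Cexp (0%R, y))%CC).
  - split; simpl; [apply continuous_const | apply continuous_id].
  - apply ccont_const.
  - exact Ht.
Qed.

(** With [t = x e^(i th)] and [log t = ln x + i th], the form [G t log t dt] is closed: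
    the [x]-derivative of its [d th]-component [G t log t (i t)] is the [th]-derivative of its
    [dx]-component [G t log t e^(i th)], so that the circle integral has derivative
    [G x * 2 pi i] in the radius. *)
Lemma circle_is_derive (p : CC -> R) (G : CC -> CC) (L x : R) :
  p = fst \/ p = snd -> 0 < x < L ->
  holo_on (fun t => 0 < Cnorm t < L) G ->
  is_derive (fun x => RInt (fun th => p (circle_integrand G x th)) 0 (2 * PI)) x
    (p (G (RtoC x) * (0%R, (2 * PI)%R))%CC).
Proof.
  intros Hp Hx HG.
  assert (Hpd : forall h s d, cder h s d -> is_derive (fun u => p (h u)) s (p d))
    by (intros h s d [H1 H2]; destruct Hp as [-> | ->]; assumption).
  assert (Hpc : forall (T : UniformSpace) (h : T -> CC) s, ccont h s -> continuous (fun u => p (h u)) s)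
    by (intros T h s [H1 H2]; destruct Hp as [-> | ->]; assumption).
  pose proof HG as [G' HG'].
  set (t := fun x th => (RtoC x * Cexp (0%R, th))%CC).
  set (l := fun x th => (ln x, th) : CC).
  (* [M] is the common value of the two mixed derivatives; its summands come from differentiating
     [G], the logarithm and the last factor. *)
  set (M := fun x th => (G' (t x th) * Cexp (0%R, th) * l x th * (Ci * t x th)
     + G (t x th) * (RtoC (/ x) * (Ci * t x th))
     + G (t x th) * l x th * (Ci * Cexp (0%R, th)))%CC).
  assert (HU : forall x th, 0 < x < L -> 0 < Cnorm (t x th) < L).
  { intros y th Hy. unfold t. rewrite Cnorm_polar by lra. exact Hy. }
  assert (Dx : forall y th, 0 < y < L -> cder (fun x => circle_integrand G x th) y (M y th)).
  { intros y th Hy. destruct (HG' _ (HU y th Hy)) as (_ & _ & G3).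
    assert (Dt : cder (fun x => t x th) y (Cexp (0%R, th))).
    { unfold t. eapply cder_eq; [|apply (cder_mul (fun x => RtoC x) (fun _ => Cexp (0%R, th)) y C1 C0)];
        [ring | | apply cder_const].
      apply (cder_RtoC (fun x => x)), (@is_derive_id R_AbsRing). }
    eapply cder_eq.
    2: { unfold circle_integrand. apply (cder_mul (fun x => G (t x th) * l x th)%CC (fun x => Ci * t x th)%CC).
         - apply (cder_mul (fun x => G (t x th)) (fun x => l x th)).
           + apply (G3 (fun x => t x th) y _ eq_refl Dt).
           + instantiate (1 := RtoC (/ y)). split; simpl.
             * apply is_derive_ln. lra.
             * apply (@is_derive_const R_AbsRing R_NormedModule).
         - apply (cder_mul (fun _ => Ci) (fun x => t x th) y C0 _ (cder_const Ci y) Dt). }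
    unfold M. ring. }
  assert (Dth : forall y, 0 < y < L -> forall th,
     cder (fun th => G (t y th) * l y th * Cexp (0%R, th))%CC th (M y th)).
  { intros y Hy th. destruct (HG' _ (HU y th Hy)) as (_ & _ & G3).
    assert (Dt : cder (fun th => t y th) th (Ci * t y th)%CC).
    { unfold t. eapply cder_eq; [|apply (cder_mul (fun _ => RtoC y) (fun th => Cexp (0%R, th)) th C0 _
        (cder_const _ _) (Cexp_i_derivative th))]. ring. }
    eapply cder_eq.
    2: { apply (cder_mul (fun th => G (t y th) * l y th)%CC (fun th => Cexp (0%R, th))).
         - apply (cder_mul (fun th => G (t y th)) (fun th => l y th)).
           + apply (G3 (fun th => t y th) th _ eq_refl Dt).
           + instantiate (1 := Ci). split; simpl.
             * apply (@is_derive_const R_AbsRing R_NormedModule).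
             * apply (@is_derive_id R_AbsRing).
         - apply Cexp_i_derivative. }
    (* The two computations differ in form only where the logarithm is differentiated, giving [1/y]
       in the radius and [i] in the angle; [t / y = e^(i th)] reconciles them. *)
    unfold M. assert (E : (RtoC (/ y) * t y th)%CC = Cexp (0%R, th)).
    { unfold t. apply CC_eq; simpl; field; lra. }
    transitivity (G' (t y th) * Cexp (0%R, th) * l y th * (Ci * t y th)
      + G (t y th) * (Ci * (RtoC (/ y) * t y th)) + G (t y th) * l y th * (Ci * Cexp (0%R, th)))%CC;
      [rewrite E|]; ring. }
  (* Joint continuity of the derivative is what permits differentiation under the integral sign. *)
  assert (CM : forall y th, 0 < y < L ->
     @ccont (prod_UniformSpace R_UniformSpace R_UniformSpace) (fun z => M (fst z) (snd z)) (y, th)).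
  { intros y th Hy. destruct (HG' _ (HU y th Hy)) as (G1 & G2 & _).
    set (T2 := prod_UniformSpace R_UniformSpace R_UniformSpace).
    assert (C1' : continuous (fun z : T2 => fst z) (y, th)) by apply (@continuous_fst R_UniformSpace R_UniformSpace).
    assert (C2' : continuous (fun z : T2 => snd z) (y, th)) by apply (@continuous_snd R_UniformSpace R_UniformSpace).
    assert (Ce : @ccont T2 (fun z => Cexp (0%R, snd z)) (y, th)).
    { apply (ccont_exp (fun z : T2 => (0%R, snd z) : CC)). split; [apply continuous_const | exact C2']. }
    assert (Ct : @ccont T2 (fun z => t (fst z) (snd z)) (y, th)).
    { unfold t. apply ccont_mul; [|exact Ce]. split; [exact C1' | apply continuous_const]. }
    assert (Cl : @ccont T2 (fun z => l (fst z) (snd z)) (y, th)).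
    { split; [|exact C2']. apply (continuous_comp (fun z : T2 => fst z) ln); [exact C1'|].
      apply (@ex_derive_continuous R_AbsRing R_NormedModule). eexists. apply is_derive_ln. simpl. lra. }
    assert (Ci' : @ccont T2 (fun z => RtoC (/ fst z)) (y, th)).
    { split; [|apply continuous_const]. apply (continuous_comp (fun z : T2 => fst z) Rinv); [exact C1'|].
      apply continuous_Rinv. simpl. lra. }
    pose proof (G1 T2 (fun z => t (fst z) (snd z)) (y, th) eq_refl Ct) as CG.
    pose proof (G2 T2 (fun z => t (fst z) (snd z)) (y, th) eq_refl Ct) as CG'.
    pose proof (ccont_mul _ _ _ (ccont_const Ci (y, th)) Ct) as Cit.
    exact (ccont_add _ _ _ (ccont_add _ _ _
      (ccont_mul _ _ _ (ccont_mul _ _ _ (ccont_mul _ _ _ CG' Ce) Cl) Cit)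
      (ccont_mul _ _ _ CG (ccont_mul _ _ _ Ci' Cit)))
      (ccont_mul _ _ _ (ccont_mul _ _ _ CG Cl) (ccont_mul _ _ _ (ccont_const Ci (y, th)) Ce))). }
  assert (Hloc : locally x (fun y => 0 < y < L)).
  { apply (open_and (fun y => 0 < y) (fun y => y < L)); [apply open_gt | apply open_lt | exact Hx]. }
  assert (HPI : 0 <= 2 * PI) by (pose proof PI_RGT_0; lra).
  evar_last.
  - apply (is_derive_RInt_param (fun x th => p (circle_integrand G x th))).
    + apply (filter_imp _ _ (fun y Hy => fun th _ => ex_intro _ _ (Hpd _ _ _ (Dx y th Hy))) Hloc).
    + intros th _. apply (continuity_2d_pt_ext_loc (fun x th => p (M x th))).
      * destruct Hloc as [e He]. exists e. intros u v Hu _. symmetry.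
        apply is_derive_unique, Hpd, Dx, He. exact Hu.
      * apply continuity_2d_pt_filterlim.
        apply (Hpc _ (fun z => M (fst z) (snd z)) (x, th)), CM, Hx.
    + refine (filter_imp _ _ _ Hloc). intros y Hy.
      apply (@ex_RInt_continuous R_CompleteNormedModule). intros th _.
      apply (Hpc _ (circle_integrand G y) th), (circle_integrand_continuous _ _ _ _ HG), HU, Hy.
  (* Read as an angular derivative, [M] integrates to a boundary difference. Between the angles [0]
     and [2 pi] both [G] and [e^(i th)] return to their values, and only the logarithm changes, by
     [2 pi i]. *)
  - transitivity (RInt (fun th => p (M x th)) 0 (2 * PI)).
    { apply RInt_ext. intros th _. apply is_derive_unique, Hpd, Dx, Hx. }
    apply (@is_RInt_unique R_CompleteNormedModule).
    evar_last.
    + apply (@is_RInt_derive R_CompleteNormedModule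
        (fun th => p (G (t x th) * l x th * Cexp (0%R, th))%CC) (fun th => p (M x th))).
      * intros th _. apply (Hpd (fun th => G (t x th) * l x th * Cexp (0%R, th))%CC), Dth, Hx.
      * intros th _. apply (Hpc R_UniformSpace (fun th => M x th)).
        destruct (CM x th Hx) as [K1 K2].
        assert (Cp : continuous (fun th : R_UniformSpace => (x, th) : prod_UniformSpace R_UniformSpace R_UniformSpace) th).
        { apply filterlim_locally. intros eps. exists eps. intros y Hy.
          split; [apply ball_center | exact Hy]. }
        split.
        -- exact (continuous_comp (fun th => (x, th)) (fun z => fst (M (fst z) (snd z))) th Cp K1).
        -- exact (continuous_comp (fun th => (x, th)) (fun z => snd (M (fst z) (snd z))) th Cp K2).
    + assert (E2 : Cexp (0%R, (2 * PI)%R) = C1).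
      { unfold Cexp; simpl. rewrite exp_0, cos_2PI, sin_2PI. apply CC_eq; simpl; ring. }
      assert (E0 : Cexp (0%R, 0%R) = C1) by exact Cexp_0.
      assert (T2 : t x (2 * PI) = RtoC x) by (unfold t; rewrite E2; ring).
      assert (T0 : t x 0 = RtoC x) by (unfold t; rewrite E0; ring).
      rewrite T2, T0, E2, E0. unfold l, minus, plus, opp; simpl.
      destruct Hp as [-> | ->]; simpl; eq_in_R; ring.
Qed.

(** The derivative found in [circle_is_derive] is integrated over the radius. The strict bound
    [lam2 < L] leaves room for differentiability at [lam2] itself. *)
Lemma circle_Chasles (G : CC -> CC) (L lam1 lam2 : R) (v1 v2 : CC) :
  0 < lam1 -> lam1 <= lam2 -> lam2 < L ->
  holo_on (fun t => 0 < Cnorm t < L) G ->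
  CRInt (circle_integrand G lam1) 0 (2 * PI) v1 ->
  CRInt (circle_integrand G lam2) 0 (2 * PI) v2 ->
  CRInt (fun x => G (RtoC x) * (0%R, (2 * PI)%R))%CC lam1 lam2 (v2 - v1)%CC.
Proof.
  intros H1 H12 H2 HG. rewrite !CRInt_iff. intros [A1 A2] [B1 B2].
  assert (HC : forall x, 0 < x < L -> ccont (fun x => G (RtoC x) * (0%R, (2 * PI)%R))%CC x).
  { intros x Hx. pose proof HG as [G' HG'].
    destruct (HG' (RtoC x)) as (G1 & _ & _).
    { rewrite Cnorm_RtoC, Rabs_pos_eq; lra. }
    apply ccont_mul; [|apply ccont_const]. apply (G1 _ (fun x => RtoC x) x eq_refl).
    split; [apply continuous_id | apply continuous_const]. }
  assert (K : forall p : CC -> R, p = fst \/ p = snd ->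
    is_RInt (fun th => p (circle_integrand G lam1 th)) 0 (2 * PI) (p v1) ->
    is_RInt (fun th => p (circle_integrand G lam2 th)) 0 (2 * PI) (p v2) ->
    is_RInt (fun x => p (G (RtoC x) * (0%R, (2 * PI)%R))%CC) lam1 lam2 (p v2 - p v1)).
  { intros p Hp I1 I2.
    apply (@is_RInt_unique R_CompleteNormedModule) in I1, I2. rewrite <- I1, <- I2.
    apply (@is_RInt_derive R_CompleteNormedModule
      (fun x => RInt (fun th => p (circle_integrand G x th)) 0 (2 * PI))).
    - rewrite Rmin_left, Rmax_right by lra. intros x Hx. apply (circle_is_derive p G L); [assumption | lra | assumption].
    - rewrite Rmin_left, Rmax_right by lra. intros x Hx.
      destruct (HC x ltac:(lra)) as [C1 C2]. destruct Hp as [-> | ->]; assumption. }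
  split; [apply (K fst); auto | apply (K snd); auto].
Qed.

(** The two half-lines carry the values [ln x] and [ln x + 2 pi i] of the logarithm and opposite
    orientations, so together they contribute the integral of [G x * 2 pi i]. *)
Definition is_contour (lam : R) (G : CC -> CC) (v : CC) : Prop :=
  exists vj vc, CImpInt (fun x => G (RtoC x) * (0%R, (2 * PI)%R))%CC lam vj /\
    CRInt (circle_integrand G lam) 0 (2 * PI) vc /\ v = (vj + vc)%CC.

Lemma is_contour_add lam F G u v : is_contour lam F u -> is_contour lam G v ->
  is_contour lam (fun t => F t + G t)%CC (u + v)%CC.
Proof.
  intros (uj & uc & U1 & U2 & ->) (vj & vc & V1 & V2 & ->).
  exists (uj + vj)%CC, (uc + vc)%CC. split; [|split; [|ring]].
  - eapply CImpInt_ext; [|exact (CImpInt_add _ _ _ _ _ U1 V1)]. intros; simpl; ring.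
  - eapply CRInt_ext; [| |exact (CRInt_add _ _ _ _ _ _ U2 V2)]; [|pose proof PI_RGT_0; lra].
    intros; unfold circle_integrand; simpl; ring.
Qed.

Lemma is_contour_scale lam z F u : is_contour lam F u ->
  is_contour lam (fun t => z * F t)%CC (z * u)%CC.
Proof.
  intros (uj & uc & U1 & U2 & ->).
  exists (z * uj)%CC, (z * uc)%CC. split; [|split; [|ring]].
  - eapply CImpInt_ext; [|exact (CImpInt_scale z _ _ _ U1)]. intros; simpl; ring.
  - eapply CRInt_ext; [| |exact (CRInt_scale z _ _ _ _ U2)]; [|pose proof PI_RGT_0; lra].
    intros; unfold circle_integrand; simpl; ring.
Qed.

(** The last hypothesis serves the empty sum: scaling any contour value of the zero function by 0
    shows that 0 is one as well. *)
Lemma is_contour_csum lam (F : nat -> CC -> CC) (u : nat -> CC) n :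
  (forall i, (i < n)%nat -> is_contour lam (F i) (u i)) -> (exists v, is_contour lam (fun _ => C0) v) ->
  is_contour lam (fun t => csum (fun i => F i t) n) (csum u n).
Proof.
  intros H [v Hv]. induction n as [|n IH].
  - simpl. pose proof (is_contour_scale lam C0 _ _ Hv) as K.
    replace (C0 * v)%CC with C0 in K by ring.
    replace (fun _ : CC => (C0 * C0)%CC) with (fun _ : CC => C0) in K; [exact K|].
    apply functional_extensionality; intros; ring.
  - simpl. apply is_contour_add; [apply IH; intros; apply H; lia | apply H; lia].
Qed.

(** What the circle gains between the two radii is exactly what the half-line loses. *)
Lemma is_contour_radius (G : CC -> CC) (L lam1 lam2 : R) (v1 v2 : CC) :
  0 < lam1 -> lam1 <= lam2 -> lam2 < L -> holo_on (fun t => 0 < Cnorm t < L) G ->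
  is_contour lam1 G v1 -> is_contour lam2 G v2 -> v1 = v2.
Proof.
  intros H1 H12 H2 HG (j1 & c1 & J1 & K1 & ->) (j2 & c2 & J2 & K2 & ->).
  pose proof (circle_Chasles G L lam1 lam2 c1 c2 H1 H12 H2 HG K1 K2) as I.
  rewrite (CImpInt_unique _ _ _ _ J1 (CImpInt_Chasles _ _ _ _ _ H12 I J2)). ring.
Qed.

(** * The integrand of [P_r] *)

Definition regular (om : list CC) (t : CC) : Prop :=
  t <> C0 /\ forall o, In o om -> (C1 - Cexp (- (o * t)))%CC <> C0.

Lemma holo_P_integrand om k w : holo_on (regular om) (P_integrand om k w).
Proof.
  assert (Hlin : forall U z, holo_on U (fun t => Cexp (- (z * t)))%CC).
  { intros U z. apply holo_exp.
    pose proof (holo_mul U (fun _ => - z)%CC (fun t => t) (holo_const U _) (holo_id U)) as H.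
    replace (fun t => - (z * t))%CC with (fun t => - z * t)%CC; [exact H|].
    apply functional_extensionality; intros t; ring. }
  unfold P_integrand. apply holo_mul; [apply holo_mul|].
  - induction om as [|o om IH]; [exact (holo_const _ C1)|].
    refine (holo_mul _ (fun t => / (C1 - Cexp (- (o * t))))%CC (fun t => f_omega om t) _ _).
    + apply (holo_inv _ (fun t => C1 - Cexp (- (o * t)))%CC).
      * intros t [_ Ht]. apply Ht. now left.
      * pose proof (holo_add (regular (o :: om)) _ _ (holo_const _ C1)
          (holo_mul _ _ _ (holo_const _ (- C1)%CC) (Hlin _ o))) as H.
        replace (fun t => C1 - Cexp (- (o * t)))%CC with (fun t => C1 + - C1 * Cexp (- (o * t)))%CC;
          [exact H|].
        apply functional_extensionality; intros t; ring.
    + apply (holo_weaken (regular om)); [|exact IH].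
      intros t [H0 Ht]. split; [exact H0|]. intros u Hu. apply Ht. now right.
  - apply Hlin.
  - apply holo_powz. now intros t [Ht _].
Qed.

Lemma Cnorm_one_sub_exp (o : CC) (x : R) :
  1 - exp (- (Re o * x)) <= Cnorm (C1 - Cexp (- (o * RtoC x)))%CC.
Proof.
  pose proof (Cnorm_add (C1 - Cexp (- (o * RtoC x)))%CC (Cexp (- (o * RtoC x)))%CC) as H.
  replace (C1 - Cexp (- (o * RtoC x)) + Cexp (- (o * RtoC x)))%CC with C1 in H by ring.
  rewrite Cnorm_1, Cnorm_exp in H. unfold Re.
  replace (fst (- (o * RtoC x))%CC) with (- (fst o * x)) in H by (simpl; ring). lra.
Qed.

Lemma exp_neg_lt_1 (u x : R) : 0 < u -> 0 < x -> exp (- (u * x)) < 1.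
Proof. intros Hu Hx. rewrite <- exp_0. apply exp_increasing. nra. Qed.

Lemma regular_pos om x : (forall o, In o om -> 0 < Re o) -> 0 < x -> regular om (RtoC x).
Proof.
  intros Hom Hx. split; [apply RtoC_neq_0; lra|]. intros o Ho E.
  pose proof (Cnorm_one_sub_exp o x) as H. rewrite E, Cnorm_0 in H.
  pose proof (exp_neg_lt_1 (Re o) x (Hom o Ho) Hx). lra.
Qed.

Lemma cos_lt_1 y : 0 < Rabs y < 2 * PI -> cos y < 1.
Proof.
  intros Hy. replace (cos y) with (cos (2 * (Rabs y / 2))).
  2: { replace (2 * (Rabs y / 2)) with (Rabs y) by field.
       unfold Rabs. destruct (Rcase_abs y); [apply cos_neg | reflexivity]. }
  rewrite cos_2a_sin.
  assert (0 < sin (Rabs y / 2)) by (apply sin_gt_0; lra). nra.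
Qed.

(** Taking norms gives [Re z = 0]; then [cos (Im z) = 1] with [|Im z| < 2 pi] leaves only
    [Im z = 0]. This is the source of the bound [|2 pi / o|] on the radius. *)
Lemma Cexp_eq_1 (z : CC) : Cexp z = C1 -> Cnorm z < 2 * PI -> z = C0.
Proof.
  intros E Hz.
  assert (H0 : fst z = 0).
  { apply exp_inv. rewrite exp_0, <- Cnorm_exp, E. apply Cnorm_1. }
  assert (Hc : cos (snd z) = 1).
  { apply (f_equal fst) in E. unfold Cexp, C1 in E. simpl in E. rewrite H0, exp_0 in E. lra. }
  apply CC_eq; simpl; [exact H0|].
  destruct (Req_dec (snd z) 0) as [H|H]; [exact H|].
  pose proof (cos_lt_1 (snd z)) as K. pose proof (Rabs_pos_lt _ H). pose proof (Cnorm_snd z). lra.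
Qed.

Lemma admissible_regular om lam t : (forall o, In o om -> o <> C0) -> admissible om lam ->
  0 < Cnorm t <= lam -> regular om t.
Proof.
  intros Hom [_ Hadm] Ht.
  assert (Ht0 : t <> C0) by (intros E; rewrite E, Cnorm_0 in Ht; lra).
  split; [exact Ht0|]. intros o Ho E.
  pose proof (Cnorm_gt_0 o (Hom o Ho)) as Hn. specialize (Hadm o Ho).
  pose proof PI_RGT_0. rewrite Cnorm_mul, Cnorm_RtoC, Cnorm_inv, Rabs_pos_eq in Hadm by lra.
  assert (Hlt : Cnorm (- (o * t))%CC < 2 * PI).
  { rewrite Cnorm_opp, Cnorm_mul. apply Rle_lt_trans with (Cnorm o * lam).
    - apply Rmult_le_compat_l; lra.
    - replace (2 * PI) with (Cnorm o * (2 * PI * / Cnorm o)) by (field; lra).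
      apply Rmult_lt_compat_l; lra. }
  apply (Cmul_neq_0 o t (Hom o Ho) Ht0).
  replace (o * t)%CC with (- - (o * t))%CC by ring.
  rewrite (Cexp_eq_1 (- (o * t))%CC); [ring | | exact Hlt].
  transitivity (C1 - (C1 - Cexp (- (o * t))))%CC; [ring|]. rewrite E. ring.
Qed.

(** There are finitely many strict inequalities, so they leave room; the extra room provides the
    open annulus around the circle on which the radius may vary. *)
Lemma admissible_larger om lam : admissible om lam -> exists L, lam < L /\ admissible om L.
Proof.
  intros [H0 H].
  assert (K : exists L, lam < L /\ forall o, In o om -> L < Cnorm (RtoC (2 * PI) * / o)%CC).
  { clear H0. induction om as [|o om IH].
    - exists (lam + 1). split; [lra|]. intros o [].
    - destruct IH as (L & HL & K); [intros; apply H; now right|].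
      specialize (H o (or_introl eq_refl)).
      exists (Rmin L ((lam + Cnorm (RtoC (2 * PI) * / o)%CC) / 2)). split; [apply Rmin_glb_lt; lra|].
      intros u [<-|Hu].
      + eapply Rle_lt_trans; [apply Rmin_r|]. lra.
      + eapply Rle_lt_trans; [apply Rmin_l|]. now apply K. }
  destruct K as (L & HL & K). exists L. split; [exact HL|]. split; [lra | exact K].
Qed.

Lemma admissible_app_l om al lam : admissible (om ++ al) lam -> admissible om lam.
Proof. intros [H0 H]. split; [exact H0|]. intros o Ho. apply H, in_or_app. now left. Qed.

Lemma f_omega_bound om eta : (forall o, In o om -> 0 < Re o) -> 0 < eta ->
  exists M, 0 <= M /\ forall x, eta <= x -> Cnorm (f_omega om (RtoC x)) <= M.
Proof.
  intros Hom Heta. induction om as [|o om IH].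
  - exists 1. split; [lra|]. intros x _. change (f_omega nil (RtoC x)) with C1. rewrite Cnorm_1. lra.
  - destruct IH as (M & HM & H); [intros; apply Hom; now right|].
    specialize (Hom o (or_introl eq_refl)).
    set (m := 1 - exp (- (Re o * eta))).
    assert (Hm : 0 < m) by (unfold m; pose proof (exp_neg_lt_1 (Re o) eta Hom Heta); lra).
    exists (/ m * M). split; [apply Rmult_le_pos; [apply Rlt_le, Rinv_0_lt_compat|]; lra|].
    intros x Hx. rewrite f_omega_cons, Cnorm_mul, Cnorm_inv.
    assert (m <= Cnorm (C1 - Cexp (- (o * RtoC x)))%CC).
    { eapply Rle_trans; [|apply Cnorm_one_sub_exp]. unfold m.
      assert (exp (- (Re o * x)) <= exp (- (Re o * eta))) by (apply exp_le; nra). lra. }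
    apply Rmult_le_compat; [apply Rlt_le, Rinv_0_lt_compat; lra | apply Cnorm_ge_0 | | now apply H].
    apply Rinv_le_contravar; lra.
Qed.

(** For [n > 0], write [x = n (x/n)] and use [x/n <= e^(x/n)], raised to the power [n]. *)
Lemma pow_le_exp (n : nat) (x : R) : 0 < x -> x ^ n <= INR n ^ n * exp x.
Proof.
  intros Hx. destruct n as [|n].
  - simpl. rewrite Rmult_1_l. pose proof (exp_ineq1 x ltac:(lra)). lra.
  - assert (Hn : 0 < INR (S n)) by (apply lt_0_INR; lia).
    assert (He : forall y m, exp (INR m * y) = exp y ^ m).
    { intros y m. induction m as [|m IH]; [simpl; rewrite Rmult_0_l; apply exp_0|].
      rewrite S_INR, Rmult_plus_distr_r, exp_plus, IH, Rmult_1_l. simpl. ring. }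
    replace x with (INR (S n) * (x / INR (S n))) at 2 by (field; lra).
    rewrite He, <- Rpow_mult_distr. apply pow_incr. split; [lra|].
    assert (Hy : 0 < x / INR (S n)) by (now apply Rdiv_lt_0_compat).
    pose proof (exp_ineq1 (x / INR (S n)) ltac:(lra)).
    replace x with (INR (S n) * (x / INR (S n))) at 1 by (field; lra).
    apply Rmult_le_compat_l; lra.
Qed.

Lemma Cpowz_bound (k : Z) eta : 0 < eta ->
  exists M, 0 <= M /\ forall x, eta <= x -> Cnorm (Cpowz (RtoC x) k) <= M * exp x.
Proof.
  intros Heta. unfold Cpowz. destruct (Z.leb 0 k).
  - exists (INR (Z.to_nat k) ^ Z.to_nat k). split; [apply pow_le, pos_INR|].
    intros x Hx. rewrite Cnorm_pow, Cnorm_RtoC, Rabs_pos_eq by lra. apply pow_le_exp; lra.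
  - set (n := Z.to_nat (- k)). exists (/ eta ^ n).
    assert (Hn : 0 < eta ^ n) by (now apply pow_lt).
    split; [now apply Rlt_le, Rinv_0_lt_compat|].
    intros x Hx. rewrite Cnorm_inv, Cnorm_pow, Cnorm_RtoC, Rabs_pos_eq by lra.
    pose proof (exp_ineq1 x ltac:(lra)).
    assert (/ x ^ n <= / eta ^ n) by (apply Rinv_le_contravar; [assumption | apply pow_incr; lra]).
    assert (0 < / eta ^ n) by (now apply Rinv_0_lt_compat). nra.
Qed.

(** The constant does not depend on [w]. The loss of 1 in the rate pays for bounding the power of
    [x] by [e^x]. *)
Lemma P_integrand_bound om k eta : (forall o, In o om -> 0 < Re o) -> 0 < eta ->
  exists M, 0 <= M /\ forall w x, eta <= x ->
    Cnorm (P_integrand om k w (RtoC x)) <= M * exp (- (Re w - 1) * x).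
Proof.
  intros Hom Heta.
  destruct (f_omega_bound om eta Hom Heta) as (M1 & HM1 & H1).
  destruct (Cpowz_bound (- k - 1) eta Heta) as (M2 & HM2 & H2).
  exists (M1 * M2). split; [now apply Rmult_le_pos|]. intros w x Hx.
  unfold P_integrand. rewrite !Cnorm_mul, Cnorm_exp.
  replace (fst (- (w * RtoC x))%CC) with (- (Re w * x)) by (unfold Re; simpl; ring).
  replace (exp (- (Re w - 1) * x)) with (exp (- (Re w * x)) * exp x)
    by (rewrite <- exp_plus; f_equal; ring).
  specialize (H1 x Hx). specialize (H2 x Hx).
  replace (M1 * M2 * (exp (- (Re w * x)) * exp x)) with (M1 * exp (- (Re w * x)) * (M2 * exp x)) by ring.
  pose proof (exp_pos (- (Re w * x))).
  apply Rmult_le_compat; [|apply Cnorm_ge_0| |exact H2].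
  - apply Rmult_le_pos; [apply Cnorm_ge_0 | lra].
  - apply Rmult_le_compat_r; lra.
Qed.

Lemma P_integrand_continuous om k w x : (forall o, In o om -> 0 < Re o) -> 0 < x ->
  ccont (fun x => P_integrand om k w (RtoC x)) x.
Proof.
  intros Hom Hx. destruct (holo_P_integrand om k w) as [G' HG].
  destruct (HG (RtoC x) (regular_pos om x Hom Hx)) as (G1 & _ & _).
  apply (G1 R_UniformSpace (fun x => RtoC x) x eq_refl).
  split; [apply continuous_id | apply continuous_const].
Qed.

Lemma Re_pos_all_neq_0 (om : list CC) :
  (forall o, In o om -> 0 < Re o) -> forall o, In o om -> o <> C0.
Proof. intros H o Ho. now apply Re_pos_neq_0, H. Qed.

Lemma is_contour_ex om k w lam : (forall o, In o om -> 0 < Re o) -> admissible om lam ->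
  1 < Re w -> exists v, is_contour lam (P_integrand om k w) v.
Proof.
  intros Hom Hadm Hw. pose proof Hadm as [Hlam _]. pose proof PI_RGT_0.
  destruct (P_integrand_bound om k lam Hom Hlam) as (M & HM & HB).
  destruct (CImpInt_intro (fun x => P_integrand om k w (RtoC x) * (0%R, (2 * PI)%R))%CC
    (M * Cnorm (0%R, (2 * PI)%R)) (Re w - 1) lam) as [vj Hj].
  - lra.
  - apply Rmult_le_pos; [lra | apply Cnorm_ge_0].
  - intros x Hx. apply ccont_mul; [apply P_integrand_continuous; [assumption | lra] | apply ccont_const].
  - intros x Hx. rewrite Cnorm_mul. specialize (HB w x Hx).
    pose proof (Cnorm_ge_0 (0%R, (2 * PI)%R)). nra.
  - destruct (CRInt_continuous (circle_integrand (P_integrand om k w) lam) 0 (2 * PI)) as [vc Hc].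
    + lra.
    + intros th _. apply (circle_integrand_continuous _ _ _ _ (holo_P_integrand om k w)).
      apply (admissible_regular om lam); [now apply Re_pos_all_neq_0 | assumption|].
      rewrite Cnorm_polar by assumption. lra.
    + exists (vj + vc)%CC, vj, vc. split; [exact Hj|]. split; [exact Hc | reflexivity].
Qed.

Lemma ln_bound eta : 0 < eta -> exists M, 0 <= M /\ forall x, eta <= x -> Rabs (ln x) <= M * exp x.
Proof.
  intros Heta. exists (1 + Rabs (ln eta)). pose proof (Rabs_pos (ln eta)). split; [lra|].
  intros x Hx. pose proof (exp_ineq1 x ltac:(lra)) as He.
  assert (H1 : ln x < x).
  { apply exp_lt_inv. rewrite exp_ln by lra. lra. }
  assert (H2 : ln eta <= ln x) by (apply ln_le; lra).
  pose proof (Rle_abs (- ln eta)) as H3. rewrite Rabs_Ropp in H3.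
  apply Rabs_le. split; nra.
Qed.

(** The integrals of [G ln x] along the two half-lines cancel, but for this each must converge by
    itself; hence the bound 2, one unit for the power and one for the logarithm. *)
Lemma contour_int_value om k w lam v : (forall o, In o om -> 0 < Re o) -> 0 < lam -> 2 < Re w ->
  is_contour lam (P_integrand om k w) v -> contour_int lam om k w = v.
Proof.
  intros Hom Hlam Hw (vj & vc & Hj & Hc & ->).
  destruct (P_integrand_bound om k lam Hom Hlam) as (M & HM & HB).
  destruct (ln_bound lam Hlam) as (M' & HM' & HL).
  destruct (CImpInt_intro (fun x => P_integrand om k w (RtoC x) * RtoC (ln x))%CC
    (M * M') (Re w - 2) lam) as [vi Hi].
  - lra.
  - now apply Rmult_le_pos.
  - intros x Hx. apply ccont_mul; [apply P_integrand_continuous; [assumption | lra]|].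
    split; [|apply continuous_const]. apply (@ex_derive_continuous R_AbsRing R_NormedModule).
    eexists. apply is_derive_ln. lra.
  - intros x Hx. rewrite Cnorm_mul, Cnorm_RtoC. specialize (HB w x Hx). specialize (HL x Hx).
    replace (exp (- (Re w - 2) * x)) with (exp (- (Re w - 1) * x) * exp x)
      by (rewrite <- exp_plus; f_equal; ring).
    replace (M * M' * (exp (- (Re w - 1) * x) * exp x))
      with (M * exp (- (Re w - 1) * x) * (M' * exp x)) by ring.
    apply Rmult_le_compat; try assumption; [apply Cnorm_ge_0 | apply Rabs_pos].
  - assert (Ho : CImpInt (fun x => P_integrand om k w (RtoC x) * (ln x, (2 * PI)%R))%CC lam (vi + vj)%CC).
    { eapply CImpInt_ext; [|exact (CImpInt_add _ _ _ _ _ Hi Hj)].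
      intros x _. cbv beta. transitivity (P_integrand om k w (RtoC x) *
        (RtoC (ln x) + (0%R, (2 * PI)%R)))%CC; [ring|].
      f_equal. apply CC_eq; simpl; ring. }
    assert (V : forall h u, CImpInt h lam u -> cimpint h lam = u).
    { intros h u Hu. apply (CImpInt_unique h lam); [|exact Hu].
      unfold cimpint. apply epsilon_spec. now exists u. }
    assert (W : cint (circle_integrand (P_integrand om k w) lam) 0 (2 * PI) = vc).
    { apply (CRInt_unique (circle_integrand (P_integrand om k w) lam) 0 (2 * PI)); [|exact Hc].
      unfold cint. apply epsilon_spec. now exists vc. }
    transitivity (- vi + (vc + (vi + vj)))%CC; [|ring].
    exact (f_equal2 Cadd (f_equal Copp (V _ _ Hi)) (f_equal2 Cadd W (V _ _ Ho))).
Qed.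

Lemma is_contour_P_radius om k w lam1 lam2 v1 v2 : (forall o, In o om -> 0 < Re o) ->
  admissible om lam1 -> admissible om lam2 ->
  is_contour lam1 (P_integrand om k w) v1 -> is_contour lam2 (P_integrand om k w) v2 -> v1 = v2.
Proof.
  intros Hom.
  assert (K : forall lam1 lam2 v1 v2, admissible om lam1 -> admissible om lam2 -> lam1 <= lam2 ->
    is_contour lam1 (P_integrand om k w) v1 -> is_contour lam2 (P_integrand om k w) v2 -> v1 = v2).
  { clear lam1 lam2 v1 v2. intros lam1 lam2 v1 v2 A1 A2 H12 H1 H2.
    destruct (admissible_larger om lam2 A2) as (L & HL & AL).
    apply (is_contour_radius (P_integrand om k w) L lam1 lam2 v1 v2 (proj1 A1) H12 HL);
      [|assumption|assumption].
    apply (holo_weaken (regular om)); [|apply holo_P_integrand].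
    intros t Ht. apply (admissible_regular om L); [now apply Re_pos_all_neq_0 | assumption | lra]. }
  intros A1 A2 H1 H2. destruct (Rle_dec lam1 lam2) as [H|H].
  - now apply (K lam1 lam2).
  - symmetry. apply (K lam2 lam1); try assumption. lra.
Qed.

(** * Estimates for the sector and for a small circle *)

(** With [T = |tan phi|] one has [|Im w| <= T Re w] in the sector, so [|w| <= (1 + T) Re w]. *)
Lemma sector_Re delta : 0 < delta ->
  exists c, 0 < c /\ forall w, in_sector delta w -> c * Cnorm w <= Re w.
Proof.
  intros Hd. pose proof PI_RGT_0.
  set (phi := PI / 2 - delta). set (T := Rabs (tan phi)).
  pose proof (Rabs_pos (tan phi)) as HT. fold T in HT.
  exists (/ (1 + T)). split; [apply Rinv_0_lt_compat; lra|].
  intros w [Hre Hat]. fold phi in Hat.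
  (* For [delta > pi/2] the sector is empty; a point [w] in it guarantees that [phi] lies in the
     range where [atan] inverts [tan]. *)
  assert (Hphi : 0 <= phi) by (eapply Rle_trans; [apply Rabs_pos | exact Hat]).
  assert (Hq : forall q, atan q <= phi -> q <= T).
  { intros q Hq. apply Rle_trans with (tan phi); [|apply Rle_abs].
    apply Rnot_lt_le. intros Hlt. apply atan_increasing in Hlt.
    rewrite atan_tan in Hlt by (unfold phi in *; lra). lra. }
  set (q := Im w / Re w) in *. apply Rabs_le_between in Hat.
  assert (H1 : q <= T) by (apply Hq; lra).
  assert (H2 : - q <= T) by (apply Hq; rewrite atan_opp; lra).
  assert (Him : Im w = q * Re w) by (unfold q; field; lra).
  apply Rmult_le_reg_l with (1 + T); [lra|]. rewrite <- Rmult_assoc, Rinv_r, Rmult_1_l by lra.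
  eapply Rle_trans; [apply Cnorm_le_sum|].
  change (Rabs (Re w) + Rabs (Im w) <= (1 + T) * Re w).
  rewrite Him, Rabs_mult, (Rabs_pos_eq (Re w)) by lra.
  assert (Rabs q <= T) by (apply Rabs_le; lra). nra.
Qed.

(** The radius is a square [s^2], because [|ln (s^2)| <= 2/s] then gives [s^2 |ln (s^2)| <= 2 s].
    With [2 pi <= 8] and [s <= 1] the total is at most [10 s]. *)
Lemma small_radius (A eps eta : R) : 0 <= A -> 0 < eps -> 0 < eta ->
  exists lam, 0 < lam <= eta /\ lam <= 1 /\ A * (lam * (Rabs (ln lam) + 2 * PI)) <= eps.
Proof.
  intros HA Heps Heta.
  set (s := Rmin (Rmin 1 eta) (eps / (10 * (A + 1)))).
  assert (H1 : 0 < s).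
  { unfold s. repeat apply Rmin_glb_lt; try lra. apply Rdiv_lt_0_compat; lra. }
  assert (H2 : s <= 1) by (unfold s; eapply Rle_trans; [apply Rmin_l | apply Rmin_l]).
  assert (H3 : s <= eta) by (unfold s; eapply Rle_trans; [apply Rmin_l | apply Rmin_r]).
  assert (H4 : A * (10 * s) <= eps).
  { assert (H5 : s <= eps / (10 * (A + 1))) by apply Rmin_r.
    apply Rmult_le_compat_l with (r := 10 * (A + 1)) in H5; [|lra].
    replace (10 * (A + 1) * (eps / (10 * (A + 1)))) with eps in H5 by (field; lra). nra. }
  exists (s * s). split; [split; nra|]. split; [nra|].
  assert (Hl : Rabs (ln (s * s)) <= 2 * / s).
  { rewrite ln_mult by assumption.
    assert (Hi : 0 < / s) by (now apply Rinv_0_lt_compat).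
    assert (L1 : ln s <= 0) by (rewrite <- ln_1; apply ln_le; lra).
    assert (L2 : ln (/ s) < / s).
    { apply exp_lt_inv. rewrite exp_ln by assumption. pose proof (exp_ineq1 (/ s) ltac:(lra)). lra. }
    rewrite ln_Rinv in L2 by assumption. rewrite Rabs_left1 by lra. lra. }
  eapply Rle_trans; [|exact H4]. apply Rmult_le_compat_l; [assumption|].
  apply Rle_trans with (s * s * (2 * / s + 2 * 4)).
  - apply Rmult_le_compat_l; [nra|]. pose proof PI_4. lra.
  - replace (s * s * (2 * / s + 2 * 4)) with (2 * s + 8 * (s * s)) by (field; lra). nra.
Qed.

(** * The remainder *)

(** This is [D t e^(-wt)], with the exponential kept inside so that it remains a combination of
    integrands of the form [P_integrand]. *)
Definition remainder (om al : list CC) (a : CC) (k : Z) (w t : CC) : CC :=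
  (P_integrand (om ++ al) k (w + a) t
   - sumZ (- Z.of_nat (length al)) (Z.of_nat (length om) + k)
       (fun N => abern N a al * P_integrand om (k - N) w t))%CC.

(* The sum over [N] is the Laurent polynomial of [f_al t e^(-at)] truncated just so that the
   remaining factor [t^(r+k+1)] cancels the pole of [f_om t t^(-k-1)]. *)
Lemma remainder_bound_near_0 om al a k :
  (forall o, In o om -> o <> C0) -> (forall o, In o al -> o <> C0) ->
  (- Z.of_nat (length om + length al) <= k)%Z ->
  exists M eta, 0 <= M /\ 0 < eta /\ forall w t, t <> C0 -> Cnorm t <= eta ->
    Cnorm (remainder om al a k w t) <= M * Cnorm (Cexp (- (w * t)))%CC.
Proof.
  intros Hom Hal Hk. set (r := length om). set (l := length al).
  set (K := Z.to_nat (k + Z.of_nat (r + l))).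
  destruct (expandable_f_omega om Hom) as (c & M1 & q1 & HM1 & Hq1 & H1).
  destruct (abern_expandable al a Hal) as (M2 & q2 & HM2 & Hq2 & H2).
  (* [M1] bounds [t^r f_om t], by the order 0 case of its expansion; [M2 q2^(K+1)] comes from the
     remainder of [t^l f_al t e^(-at)] after its [K + 1] terms, once [t^(K+1)] is divided out. *)
  exists (M1 * (M2 * q2 ^ S K)), (Rmin (/ (2 * q1)) (/ (2 * q2))).
  assert (Hp : 0 <= q2 ^ S K) by (apply pow_le; lra).
  split; [apply Rmult_le_pos; [lra | now apply Rmult_le_pos]|].
  split; [apply Rmin_glb_lt; apply Rinv_0_lt_compat; lra|].
  intros w t Ht Hte.
  assert (T1 : q1 * Cnorm t <= / 2).
  { replace (/ 2) with (q1 * / (2 * q1)) by (field; lra). apply Rmult_le_compat_l; [lra|].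
    eapply Rle_trans; [exact Hte | apply Rmin_l]. }
  assert (T2 : q2 * Cnorm t <= / 2).
  { replace (/ 2) with (q2 * / (2 * q2)) by (field; lra). apply Rmult_le_compat_l; [lra|].
    eapply Rle_trans; [exact Hte | apply Rmin_r]. }
  specialize (H1 O t Ht T1). specialize (H2 (S K) t Ht T2). simpl csum in H1.
  fold l in H2. fold r in H1.
  set (B := csum (fun n => abern (Z.of_nat n - Z.of_nat l) a al * Cpow t n)%CC (S K)) in *.
  set (Z0 := (/ Cpow t (S K))%CC).
  assert (E : remainder om al a k w t
    = ((Cpow t r * f_omega om t) * (Cpow t l * (f_omega al t * Cexp (- (a * t))) - B)
       * Z0 * Cexp (- (w * t)))%CC).
  { unfold remainder. rewrite sumZ_csum.
    replace (Z.to_nat (Z.of_nat (length om) + k - - Z.of_nat (length al) + 1)) with (S K)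
      by (unfold K, r, l; lia).
    rewrite (csum_ext _ (fun n => (Cpow t r * f_omega om t * Z0 * Cexp (- (w * t)))
       * (abern (Z.of_nat n - Z.of_nat l) a al * Cpow t n))%CC).
    2: { intros n Hn. unfold P_integrand.
         replace (- (k - (- Z.of_nat (length al) + Z.of_nat n)) - 1)%Z
           with (Z.of_nat (r + n) - Z.of_nat (S K))%Z by (unfold K, r, l in *; lia).
         replace (- Z.of_nat (length al) + Z.of_nat n)%Z with (Z.of_nat n - Z.of_nat l)%Z
           by (unfold l; lia).
         rewrite Cpowz_diff, Cpow_add by assumption. fold Z0. ring. }
    rewrite csum_mul_l. fold B. unfold P_integrand.
    replace (- k - 1)%Z with (Z.of_nat (r + l) - Z.of_nat (S K))%Z by (unfold K, r, l in *; lia).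
    rewrite Cpowz_diff, Cpow_add, f_omega_app by assumption. fold Z0.
    replace (- ((w + a) * t))%CC with (- (w * t) + - (a * t))%CC by ring.
    rewrite Cexp_add. ring. }
  rewrite E, Cnorm_mul. apply Rmult_le_compat_r; [apply Cnorm_ge_0|].
  rewrite Cnorm_mul, (Cnorm_mul (Cpow t r * f_omega om t)%CC).
  replace (Cpow t r * f_omega om t - C0)%CC with (Cpow t r * f_omega om t)%CC in H1 by ring.
  rewrite pow_O, Rmult_1_r in H1.
  unfold Z0. rewrite Cnorm_inv, Cnorm_pow.
  assert (Hn : 0 < Cnorm t ^ S K) by (apply pow_lt, Cnorm_gt_0, Ht).
  apply Rmult_le_reg_r with (Cnorm t ^ S K); [assumption|].
  rewrite (Rmult_assoc (_ * _)), Rinv_l, Rmult_1_r by lra.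
  replace (M1 * (M2 * q2 ^ S K) * Cnorm t ^ S K) with (M1 * (M2 * (q2 * Cnorm t) ^ S K))
    by (rewrite Rpow_mult_distr; ring).
  apply Rmult_le_compat; auto using Cnorm_ge_0.
Qed.

Lemma csum_bound_uniform (F : nat -> CC -> R -> CC) (g : CC -> R -> R) (eta : R) n :
  (forall i, exists M, 0 <= M /\ forall w x, eta <= x -> Cnorm (F i w x) <= M * g w x) ->
  exists M, 0 <= M /\ forall w x, eta <= x -> Cnorm (csum (fun i => F i w x) n) <= M * g w x.
Proof.
  intros H. induction n as [|n (M1 & HM1 & H1)].
  - exists 0. split; [lra|]. intros. simpl. rewrite Cnorm_0. lra.
  - destruct (H n) as (M2 & HM2 & H2). exists (M1 + M2). split; [lra|].
    intros w x Hx. simpl. eapply Rle_trans; [apply Cnorm_add|].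
    specialize (H1 w x Hx). specialize (H2 w x Hx). lra.
Qed.

(** In the rate, [|a|] accounts for the shift from [w] to [w + a], and 1 for the powers of [x]. *)
Lemma remainder_bound_real om al a k eta :
  (forall o, In o om -> 0 < Re o) -> (forall o, In o al -> 0 < Re o) -> 0 < eta ->
  exists M, 0 <= M /\ forall w x, eta <= x ->
    Cnorm (remainder om al a k w (RtoC x)) <= M * exp (- (Re w - (Cnorm a + 1)) * x).
Proof.
  intros Hom Hal Heta.
  destruct (P_integrand_bound (om ++ al) k eta) as (M1 & HM1 & H1).
  { intros o Ho. apply in_app_or in Ho. destruct Ho; auto. }
  { assumption. }
  destruct (csum_bound_uniform
    (fun j w x => let N := (- Z.of_nat (length al) + Z.of_nat j)%Z in
       abern N a al * P_integrand om (k - N) w (RtoC x))%CC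
    (fun w x => exp (- (Re w - 1) * x)) eta
    (Z.to_nat (Z.of_nat (length om) + k - - Z.of_nat (length al) + 1))) as (M2 & HM2 & H2).
  { intros j. set (N := (- Z.of_nat (length al) + Z.of_nat j)%Z). cbv zeta.
    destruct (P_integrand_bound om (k - N) eta Hom Heta) as (M & HM & H).
    exists (Cnorm (abern N a al) * M). split; [apply Rmult_le_pos; [apply Cnorm_ge_0 | assumption]|].
    intros w x Hx. rewrite Cnorm_mul, Rmult_assoc. apply Rmult_le_compat_l; [apply Cnorm_ge_0 | auto]. }
  exists (M1 + M2). split; [lra|]. intros w x Hx. unfold remainder. rewrite sumZ_csum.
  eapply Rle_trans; [apply Cnorm_sub|]. rewrite Rmult_plus_distr_r.
  pose proof (Cnorm_ge_0 a). pose proof (Cnorm_fst a) as Ha. apply Rabs_le_between in Ha.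
  apply Rplus_le_compat.
  - eapply Rle_trans; [apply H1; assumption|]. apply Rmult_le_compat_l; [assumption|].
    apply exp_le. unfold Re; simpl. nra.
  - eapply Rle_trans; [apply H2; assumption|]. apply Rmult_le_compat_l; [assumption|].
    apply exp_le. nra.
Qed.

(** The limit of vanishing radius is expressed by requiring [v] to be the contour value for every
    small radius. For given [w] and [eps] one such radius makes the circle contribute at most [eps],
    while the half-line bound does not involve the radius. *)
Lemma remainder_contour_bound om al a k :
  (forall o, In o om -> 0 < Re o) -> (forall o, In o al -> 0 < Re o) ->
  (- Z.of_nat (length om + length al) <= k)%Z ->
  exists M, 0 <= M /\ forall w v L, 0 < L -> Cnorm a + 1 < Re w ->
    (forall lam, 0 < lam <= L -> is_contour lam (remainder om al a k w) v) ->
    Cnorm v <= M / (Re w - (Cnorm a + 1)).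
Proof.
  intros Hom Hal Hk.
  destruct (remainder_bound_near_0 om al a k (Re_pos_all_neq_0 om Hom) (Re_pos_all_neq_0 al Hal) Hk)
    as (M1 & eta & HM1 & Heta & H1).
  destruct (remainder_bound_real om al a k eta Hom Hal Heta) as (M2 & HM2 & H2).
  set (M := Rmax M1 M2).
  assert (HM : 0 <= M) by (eapply Rle_trans; [exact HM1 | apply Rmax_l]).
  pose proof PI_RGT_0 as Hpi. pose proof (Cnorm_ge_0 a) as Ha.
  (* The factor 2 comes from integrating coordinatewise, [2 pi] from the jump of the logarithm. *)
  exists (2 * (M * (2 * PI))). split; [nra|].
  intros w v L HL Hw Hv. set (s := Re w - (Cnorm a + 1)) in *.
  assert (Hs : 0 < s) by (unfold s; lra).
  (* Both bounds are weakened to the rate [s], so that one constant serves the whole half-line down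
     to 0. *)
  assert (Hreal : forall x, 0 < x -> Cnorm (remainder om al a k w (RtoC x)) <= M * exp (- s * x)).
  { intros x Hx. pose proof (exp_pos (- s * x)). destruct (Rle_dec eta x) as [Hex|Hex].
    - eapply Rle_trans; [apply H2; assumption|]. apply Rmult_le_compat_r; [lra | apply Rmax_r].
    - eapply Rle_trans; [apply H1|].
      + apply RtoC_neq_0; lra.
      + rewrite Cnorm_RtoC, Rabs_pos_eq; lra.
      + apply Rmult_le_compat; [assumption | apply Cnorm_ge_0 | apply Rmax_l|].
        rewrite Cnorm_exp. apply exp_le. unfold s, Re. simpl. nra. }
  apply le_epsilon. intros eps Heps.
  (* On a circle of radius at most 1, [|e^(-wt)| <= e^|w|]; the remaining factors are the length of
     the angular interval and the 2 from coordinatewise integration. *)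
  set (A := 2 * (2 * PI) * (M * exp (Cnorm w))).
  assert (HA : 0 <= A).
  { unfold A. pose proof (exp_pos (Cnorm w)). apply Rmult_le_pos; [lra|]. apply Rmult_le_pos; lra. }
  destruct (small_radius A eps (Rmin L eta) HA Heps) as (lam & Hlam & Hlam1 & Hsmall).
  { now apply Rmin_glb_lt. }
  pose proof (Rmin_l L eta). pose proof (Rmin_r L eta).
  destruct (Hv lam ltac:(lra)) as (vj & vc & Hj & Hc & ->).
  eapply Rle_trans; [apply Cnorm_add|]. apply Rplus_le_compat.
  - replace (2 * (M * (2 * PI)) / s) with (2 * (M * (2 * PI) / s)) by (field; lra).
    apply (CImpInt_decay_le (fun x => remainder om al a k w (RtoC x) * (0%R, (2 * PI)%R))%CC (M * (2 * PI)) s lam vj Hs); [nra | lra | | exact Hj].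
    intros x Hx. rewrite Cnorm_mul. specialize (Hreal x ltac:(lra)).
    replace (Cnorm (0%R, (2 * PI)%R)) with (2 * PI).
    2: { replace ((0%R, (2 * PI)%R) : CC) with (Ci * RtoC (2 * PI))%CC by (apply CC_eq; simpl; ring).
         rewrite Cnorm_mul, Cnorm_Ci, Cnorm_RtoC, Rabs_pos_eq; lra. }
    nra.
  - eapply Rle_trans; [|exact Hsmall].
    set (b := M * exp (Cnorm w) * (Rabs (ln lam) + 2 * PI) * lam).
    replace (A * (lam * (Rabs (ln lam) + 2 * PI))) with (2 * (b * (2 * PI - 0)))
      by (unfold A, b; ring).
    apply (CRInt_norm_le (circle_integrand (remainder om al a k w) lam) (fun _ => b) 0 (2 * PI) vc (b * (2 * PI - 0)) ltac:(lra)); [|exact Hc|].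
    + intros th Hth. unfold circle_integrand, b.
      set (t := (RtoC lam * Cexp (0%R, th))%CC).
      assert (Hn : Cnorm t = lam) by (apply Cnorm_polar; lra).
      assert (Ht : t <> C0) by (intros E; rewrite E, Cnorm_0 in Hn; lra).
      rewrite !Cnorm_mul, Cnorm_Ci, Hn, Rmult_1_l.
      apply Rmult_le_compat_r; [lra|].
      apply Rmult_le_compat; try apply Cnorm_ge_0.
      * eapply Rle_trans; [apply H1; [assumption | rewrite Hn; lra]|].
        apply Rmult_le_compat; [assumption | apply Cnorm_ge_0 | apply Rmax_l|].
        rewrite Cnorm_exp. apply exp_le.
        eapply Rle_trans; [apply Rle_abs|]. eapply Rle_trans; [apply Cnorm_fst|].
        rewrite Cnorm_opp, Cnorm_mul, Hn. pose proof (Cnorm_ge_0 w). nra.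
      * eapply Rle_trans; [apply Cnorm_le_sum|]. simpl. rewrite (Rabs_pos_eq th) by lra. lra.
    + evar_last; [apply (@is_RInt_const R_NormedModule)|]. unfold scal, mult; simpl.
      unfold mult; simpl. eq_in_R. ring.
Qed.

Theorem theorem1p1 (om al : list CC) (a : CC) (k : Z)
  (Hom : forall o, In o om -> 0 < Re o)
  (Hal : forall o, In o al -> 0 < Re o)
  (Hk : (- Z.of_nat (length om + length al) <= k)%Z)
  (lam1 lam2 : R)
  (Hlam1 : admissible (om ++ al) lam1)
  (Hlam2 : admissible om lam2)
  (delta : R) (Hdelta : 0 < delta) :
  exists K R0 : R, forall w : CC, in_sector delta w -> R0 <= Cnorm w ->
    Cnorm (Csub (Pfun lam1 (om ++ al) k (Cadd w a))
                (sumZ (- Z.of_nat (length al)) (Z.of_nat (length om) + k)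
                   (fun N => Cmul (abern N a al) (Pfun lam2 om (k - N)%Z w))))
    <= K / Cnorm w.
Proof.
  destruct (sector_Re delta Hdelta) as (c & Hc & Hsec).
  destruct (remainder_contour_bound om al a k Hom Hal Hk) as (M & HM & HB).
  pose proof (Cnorm_ge_0 a) as Ha. pose proof PI_RGT_0 as Hpi.
  set (B := Cnorm a + 1) in *.
  assert (Hoa : forall o, In o (om ++ al) -> 0 < Re o).
  { intros o Ho. apply in_app_or in Ho. destruct Ho; auto. }
  set (z := (/ (RtoC (2 * PI) * Ci))%CC).
  (* The threshold forces [Re w >= c |w| >= 2 B + 3]. This gives [Re w - B >= c |w| / 2], whence the
     constant [2 M / c], and also [Re (w + a) > 2], as convergence of the logarithmic integrals
     requires. *)
  exists (Cnorm z * (2 * M / c)), ((2 * B + 3) / c). intros w Hw HR.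
  assert (HRe0 : 0 < Re w) by apply Hw. specialize (Hsec w Hw).
  assert (Hcw : 2 * B + 3 <= c * Cnorm w).
  { apply Rmult_le_compat_l with (r := c) in HR; [|lra].
    replace (c * ((2 * B + 3) / c)) with (2 * B + 3) in HR by (field; lra). lra. }
  assert (Hnw : 0 < Cnorm w) by (apply Cnorm_gt_0, Re_pos_neq_0, HRe0).
  assert (Hwa : 2 < Re (w + a)%CC).
  { pose proof (Cnorm_fst a) as Hf. apply Rabs_le_between in Hf. unfold Re, B in *; simpl. lra. }
  assert (Hw2 : 2 < Re w) by (unfold B in *; lra).
  set (n := Z.to_nat (Z.of_nat (length om) + k - - Z.of_nat (length al) + 1)).
  set (N := fun j => (- Z.of_nat (length al) + Z.of_nat j)%Z).
  set (u := fun j => contour_int lam2 om (k - N j) w).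
  set (v := (contour_int lam1 (om ++ al) k (w + a) - csum (fun j => abern (N j) a al * u j) n)%CC).
  (* The two sides of the theorem use unrelated radii. Radius independence moves all the integrals
     to a common [lam], where they can be combined into one; every [lam <= lam1] is admissible for
     both tuples. *)
  assert (Hcont : forall lam, 0 < lam <= lam1 -> is_contour lam (remainder om al a k w) v).
  { intros lam Hl.
    assert (A1 : admissible (om ++ al) lam).
    { destruct Hlam1 as [_ K]. split; [lra|]. intros o Ho. specialize (K o Ho). lra. }
    assert (A2 : admissible om lam) by (eapply admissible_app_l; exact A1).
    assert (P : forall om k w lam', (forall o, In o om -> 0 < Re o) -> admissible om lam ->
       admissible om lam' -> 2 < Re w ->
       is_contour lam (P_integrand om k w) (contour_int lam' om k w)).
    { clear - Hpi. intros om k w lam' Hom Ad Ad' Hw.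
      destruct (is_contour_ex om k w lam Hom Ad ltac:(lra)) as [x Hx].
      destruct (is_contour_ex om k w lam' Hom Ad' ltac:(lra)) as [y Hy].
      rewrite (contour_int_value om k w lam' y Hom (proj1 Ad') Hw Hy).
      now rewrite <- (is_contour_P_radius om k w lam lam' x y Hom Ad Ad' Hx Hy). }
    pose proof (P (om ++ al) k (w + a)%CC lam1 Hoa A1 Hlam1 Hwa) as I1.
    assert (I2 : is_contour lam (fun t => csum (fun j => abern (N j) a al * P_integrand om (k - N j) w t)%CC n)
      (csum (fun j => abern (N j) a al * u j)%CC n)).
    { apply (is_contour_csum lam (fun j t => abern (N j) a al * P_integrand om (k - N j) w t)%CC).
      - intros j _. apply is_contour_scale. now apply P.
      - pose proof (is_contour_scale lam C0 _ _ I1) as I0. eexists.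
        replace (fun _ : CC => C0) with (fun t => C0 * P_integrand (om ++ al) k (w + a) t)%CC;
          [exact I0|]. apply functional_extensionality; intros; ring. }
    pose proof (is_contour_add lam _ _ _ _ I1 (is_contour_scale lam (- C1)%CC _ _ I2)) as I.
    replace (remainder om al a k w) with
      (fun t => P_integrand (om ++ al) k (w + a) t
         + - C1 * csum (fun j => abern (N j) a al * P_integrand om (k - N j) w t) n)%CC.
    2: { apply functional_extensionality; intros t. unfold remainder. rewrite sumZ_csum.
         fold n. unfold N. ring. }
    replace v with (contour_int lam1 (om ++ al) k (w + a)
      + - C1 * csum (fun j => abern (N j) a al * u j) n)%CC by (unfold v; ring).
    exact I. }
  pose proof (HB w v lam1 (proj1 Hlam1) ltac:(unfold B in *; lra) Hcont) as Hv.
  replace (Csub _ _) with (z * v)%CC.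
  2: { unfold Pfun. fold z. rewrite (abern_app om al w a k (Re_pos_all_neq_0 om Hom) (Re_pos_all_neq_0 al Hal) Hk).
       rewrite !sumZ_csum. fold n. unfold v.
       rewrite (csum_ext (fun j => Cmul (abern (- Z.of_nat (length al) + Z.of_nat j) a al)
          (Cadd (Cmul z (contour_int lam2 om (k - (- Z.of_nat (length al) + Z.of_nat j)) w))
                (Cmul (euler_gamma, (- PI)%R) (abern (k - (- Z.of_nat (length al) + Z.of_nat j)) w om))))
        (fun j => z * (abern (N j) a al * u j)
          + (euler_gamma, (- PI)%R) * (abern (N j) a al * abern (k - N j) w om))%CC)
         by (intros; unfold u, N; cbv beta; ring).
       rewrite csum_add, !csum_mul_l. cbv beta. unfold N. ring. }
  rewrite Cnorm_mul. unfold Rdiv at 1. rewrite (Rmult_assoc (Cnorm z)).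
  apply Rmult_le_compat_l; [apply Cnorm_ge_0|].
  eapply Rle_trans; [exact Hv|].
  replace (2 * M / c * / Cnorm w) with (M * / (c * Cnorm w / 2)) by (field; lra).
  unfold Rdiv at 1. apply Rmult_le_compat_l; [assumption|].
  apply Rinv_le_contravar; [|unfold B in *; lra].
  assert (0 < c * Cnorm w) by (now apply Rmult_lt_0_compat). lra.
Qed.
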